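(* Let $M\in \mathbb{R}_{+}^{p \times q}$ be a matrix of rank $3$ and psd rank $2$, and let $A^{(1)},\dots,A^{(p)},B^{(1)},\dots,B^{(q)}\in\mathcal{S}^2_+$ be a size-$2$ psd factorization of $M$. Let $A^{(1)},\dots,A^{(\bar p)},B^{(1)},\dots,B^{(\bar q)}$ be the factors that have rank one, and for these write $A^{(i)}=a_ia_i^T$ and $B^{(j)}=b_jb_j^T$ with $a_i,b_j\in\mathbb{R}^2$. Assume that $\det(a_i,a_j)\neq 0$ for all $i\ne j$ in $\{1,\dots,\bar p\}$ and $\det(b_i,b_j)\neq 0$ for all $i\neq j$ in $\{1,\dots,\bar q\}$. For pairwise distinct $i_1,i_2,i_3\in\{1,\dots,\bar p\}$ and pairwise distinct $j_1,j_2,j_3\in\{1,\dots,\bar q\}$ consider the system of inequalities $(\ast)$: $$\frac{\det(a_{i_1},a_{i_2})\det(a_{i_1},a_{i_3})\langle a_{i_1},b_{j_1} \rangle \langle a_{i_1},b_{j_2} \rangle}{\det(b_{j_1},b_{j_3})\det(b_{j_2},b_{j_3})\langle a_{i_2},b_{j_3} \rangle \langle a_{i_3},b_{j_3} \rangle} \geq 0,$$ $$-\frac{\det(a_{i_1},a_{i_2})\det(a_{i_2},a_{i_3})\langle a_{i_2},b_{j_1} \rangle \langle a_{i_2},b_{j_2} \rangle}{\det(b_{j_1},b_{j_3})\det(b_{j_2},b_{j_3})\langle a_{i_1},b_{j_3} \rangle \langle a_{i_3},b_{j_3} \rangle} \geq 0,$$ $$\frac{\det(a_{i_1},a_{i_3})\det(a_{i_2},a_{i_3})\langle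 a_{i_3},b_{j_1} \rangle \langle a_{i_3},b_{j_2} \rangle}{\det(b_{j_1},b_{j_3})\det(b_{j_2},b_{j_3})\langle a_{i_1},b_{j_3} \rangle \langle a_{i_2},b_{j_3} \rangle} \geq 0,$$ $$\frac{\det(b_{j_1},b_{j_2})\langle a_{i_1},b_{j_1} \rangle \langle a_{i_2},b_{j_1} \rangle \langle a_{i_3},b_{j_1} \rangle}{\det(b_{j_2},b_{j_3}) \langle a_{i_1},b_{j_3} \rangle \langle a_{i_2},b_{j_3} \rangle \langle a_{i_3},b_{j_3} \rangle} \geq 0,$$ $$-\frac{\det(b_{j_1},b_{j_2})\langle a_{i_1},b_{j_2} \rangle \langle a_{i_2},b_{j_2} \rangle \langle a_{i_3},b_{j_2} \rangle}{\det(b_{j_1},b_{j_3}) \langle a_{i_1},b_{j_3} \rangle \langle a_{i_2},b_{j_3} \rangle \langle a_{i_3},b_{j_3} \rangle} \geq 0.$$ (1) If all entries of $M$ are positive, then $(A^{(1)},\dots,A^{(p)},B^{(1)},\dots,B^{(q)})$ is the unique size-$2$ psd factorization of $M$ up to $\mathrm{GL}(2)$-action if and only if there exist rank-one factors $A^{(i_1)},A^{(i_2)},A^{(i_3)},B^{(j_1)},B^{(j_2)},B^{(j_3)}$ such that $\langle a_{i_k},b_{j_l}\rangle\neq 0$ for all $k,l\in\{1,2,3\}$ and $(\ast)$ holds. (2) If $M$ has exactly one zero entry and $(A^{(1)},\dots,A^{(p)},B^{(1)},\dots,B^{(q)})$ is the unique size-$2$ psd factorization of $M$ up to $\mathrm{GL}(2)$-action,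 then there exist rank-one factors $A^{(i_1)},A^{(i_2)},A^{(i_3)},B^{(j_1)},B^{(j_2)},B^{(j_3)}$ such that $\langle a_{i_k},b_{j_l}\rangle\neq 0$ for all $k,l\in\{1,2,3\}$ except for $\langle a_{i_1},b_{j_1}\rangle$ (which is zero), and $(\ast)$ holds.
   Context: $\mathbb{R}_+^{p\times q}$ is the set of real $p\times q$ matrices with nonnegative entries; $\mathcal{S}^k_+$ is the set of real symmetric positive semidefinite (psd) $k\times k$ matrices. $\langle X,Y\rangle=\operatorname{trace}(XY)$ for symmetric matrices, and $\langle a,b\rangle=a^Tb$ for vectors; $\det(a,b)$ is the determinant of the $2\times 2$ matrix with columns $a,b$. A size-$k$ psd factorization of $M\in\mathbb{R}_+^{p\times q}$ is a tuple $A^{(1)},\dots,A^{(p)},B^{(1)},\dots,B^{(q)}\in\mathcal{S}^k_+$ with $M_{ij}=\langle A^{(i)},B^{(j)}\rangle$ for all $i,j$; the psd rank of $M$ is the smallest $k$ for which one exists. $\mathrm{GL}(2)$ acts on size-$2$ psd factorizations by $(A^{(i)},B^{(j)})\mapsto(S^TA^{(i)}S,\;S^{-1}B^{(j)}S^{-T})$, $S\in \mathrm{GL}(2)$. A factorization is unique up to $\mathrm{GL}(2)$-action if every size-$2$ psd factorization of $M$ is in its orbit under this action. *)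

(* Defs.v *)
From HB Require Import structures.
From mathcomp Require Import all_boot all_order all_algebra.
From mathcomp Require Import reals.

Set Implicit Arguments.
Unset Strict Implicit.
Unset Printing Implicit Defensive.

Import Order.TTheory GRing.Theory Num.Theory.
Local Open Scope ring_scope.

Definition psdmx (R : realType) (k : nat) (A : 'M[R]_k) : Prop :=
  A^T = A /\ forall x : 'cV[R]_k, 0 <= (x^T *m A *m x) 0 0.

Definition psd_factorization (R : realType) (p q k : nat) (M : 'M[R]_(p, q))
    (A : 'I_p -> 'M[R]_k) (B : 'I_q -> 'M[R]_k) : Prop :=
  [/\ forall i, psdmx (A i),
      forall j, psdmx (B j)
    & forall i j, M i j = \tr (A i *m B j)].

Definition has_psd_factorization (R : realType) (p q : nat)
    (M : 'M[R]_(p, q)) (k : nat) : Prop :=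
  exists (A : 'I_p -> 'M[R]_k) (B : 'I_q -> 'M[R]_k), psd_factorization M A B.

(* The psd rank as a relation: k is the least size of a psd factorization. *)
Definition psd_rank_eq (R : realType) (p q : nat)
    (M : 'M[R]_(p, q)) (k : nat) : Prop :=
  has_psd_factorization M k /\
  forall k', has_psd_factorization M k' -> (k <= k')%N.

Definition same_GL2_orbit (R : realType) (p q : nat)
    (A : 'I_p -> 'M[R]_2) (B : 'I_q -> 'M[R]_2)
    (A' : 'I_p -> 'M[R]_2) (B' : 'I_q -> 'M[R]_2) : Prop :=
  exists S : 'M[R]_2,
    [/\ S \in unitmx,
        forall i, A' i = S^T *m A i *m S
      & forall j, B' j = invmx S *m B j *m (invmx S)^T].

Definition unique_psd_factorization (R : realType) (p q : nat)
    (M : 'M[R]_(p, q)) (A : 'I_p -> 'M[R]_2) (B : 'I_q -> 'M[R]_2) : Prop :=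
  psd_factorization M A B /\
  forall (A' : 'I_p -> 'M[R]_2) (B' : 'I_q -> 'M[R]_2),
    psd_factorization M A' B' -> same_GL2_orbit A B A' B'.

Definition dotv (R : realType) (a b : 'cV[R]_2) : R := (a^T *m b) 0 0.

Definition det2 (R : realType) (a b : 'cV[R]_2) : R :=
  \det (row_mx a b : 'M[R]_2).

(* The three indices 1, 2, 3 are the elements 0, 1, 2 of 'I_3.  The
   convention x / 0 = 0 plays no role when the a's and the b's are pairwise
   independent and only <a1, b1> may vanish among the inner products. *)
Definition sign_system (R : realType) (a b : 'I_3 -> 'cV[R]_2) : Prop :=
  let a1 := a 0 in let a2 := a 1 in let a3 := a 2 in
  let b1 := b 0 in let b2 := b 1 in let b3 := b 2 in
  [/\ 0 <= (det2 a1 a2 * det2 a1 a3 * dotv a1 b1 * dotv a1 b2)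
           / (det2 b1 b3 * det2 b2 b3 * dotv a2 b3 * dotv a3 b3),
      0 <= - ((det2 a1 a2 * det2 a2 a3 * dotv a2 b1 * dotv a2 b2)
              / (det2 b1 b3 * det2 b2 b3 * dotv a1 b3 * dotv a3 b3)),
      0 <= (det2 a1 a3 * det2 a2 a3 * dotv a3 b1 * dotv a3 b2)
           / (det2 b1 b3 * det2 b2 b3 * dotv a1 b3 * dotv a2 b3),
      0 <= (det2 b1 b2 * dotv a1 b1 * dotv a2 b1 * dotv a3 b1)
           / (det2 b2 b3 * dotv a1 b3 * dotv a2 b3 * dotv a3 b3)
    & 0 <= - ((det2 b1 b2 * dotv a1 b2 * dotv a2 b2 * dotv a3 b2)
              / (det2 b1 b3 * dotv a1 b3 * dotv a2 b3 * dotv a3 b3))].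

(* An ordered choice of three distinct rank-one factors on each side. *)
Definition rank_one_triples (R : realType) (p q : nat)
    (A : 'I_p -> 'M[R]_2) (B : 'I_q -> 'M[R]_2)
    (i : 'I_3 -> 'I_p) (j : 'I_3 -> 'I_q) : Prop :=
  [/\ injective i, injective j,
      forall k, \rank (A (i k)) = 1%N
    & forall l, \rank (B (j l)) = 1%N].

(* Main.v *)
Require Import Defs.
From mathcomp Require Import all_boot all_order all_algebra.
From mathcomp Require Import reals boolp.
From mathcomp Require Import ring lra.

(** Why the theorem is true.

    Write c_j for b_j turned by a right angle, so that <a_i, b_j> = det(a_i, c_j).
    The rank-one factors A^(i) are the points a_i a_i^T of the boundary of the
    psd cone, and a rank-one B^(j) is the supporting plane that touches the cone
    at c_j c_j^T. As M has rank 3, any other factorization is obtained from the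
    given one by an invertible linear map T of the space of symmetric matrices
    ([factorization_transfer]). The orbit of the given factorization corresponds
    to the maps T that preserve the cone, and these are the congruences
    ([conformal_congruence]). So the question is which images of the
    cone contain all A^(i) while their duals contain all B^(j).

    Such a map T is compared with the identity through the quartic form
    h(x) = det(T(x x^T)) on R^2. It satisfies h(a_i) >= 0 because T(A^(i)) is
    psd, and h(c_j) <= 0 because T(c_j c_j^T) is orthogonal to a nonzero psd
    matrix. If these inequalities force h = 0, then T is a congruence and the
    factorization is unique ([rigid_unique]). Conversely, a quartic that is
    strictly positive at the a_i and strictly negative at the c_j is the
    first-order change of the determinant under a one-parameter deformation of
    the factorization that leaves the orbit ([deformation_not_unique]).

    Whether a separating quartic exists is a question about finitely many points
    of the projective line ([separation_or_alternation]). A minimal set of points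
    that cannot be separated by forms of degree 2n has at most 2n + 2 elements,
    by Helly's theorem, and at least n + 1 of each kind, since n points of one
    kind are isolated by a product of squares. So an obstruction consists of
    n + 1 points a and n + 1 points c. Testing it on the products of linear
    forms that vanish at all but two of its points gives, for n = 2, exactly the
    five inequalities of the sign system ([rigid_sign_system]); the same five
    ratios are Lagrange interpolation weights, so the sign system in turn forces
    a weakly separating quartic to vanish ([sign_system_rigid]).

    If M has one zero entry, at position (i0, j0), then the corresponding factors
    have rank one and a_i0 and c_j0 are the same projective point y. Quartics of
    the form det(x, y)^2 g(x), with g quadratic, give deformations that fix the
    ray y y^T ([generator_tangent]) and so keep the zero entry. Uniqueness
    therefore excludes a quadratic form g separating the remaining points. The
    dichotomy for n = 1 yields two further points of each kind, and with
    a_i0 and c_j0 they satisfy the sign system, of which two inequalities have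
    become trivial ([rigid_sign_system_tangent]). *)

Set Implicit Arguments.
Unset Strict Implicit.
Unset Printing Implicit Defensive.

Import Order.TTheory GRing.Theory Num.Theory.
Local Open Scope ring_scope.

(** * Binary forms and interpolation *)

Lemma ord2P (i : 'I_2) : i = 0 \/ i = 1.
Proof. by case: i => [[|[|?]]] // ?; [left|right]; apply: val_inj. Qed.

Lemma det2E (R : realType) (x y : 'cV[R]_2) :
  det2 x y = x 0 0 * y 1 0 - x 1 0 * y 0 0.
Proof.
have s0 : split (0 : 'I_(1 + 1)) = inl 0.
  by case: splitP => [j _|k /= //]; rewrite ord1.
have s1 : split (1 : 'I_(1 + 1)) = inr 0.
  by case: splitP => [[[|?]] //|k _]; rewrite ord1.
rewrite /det2 (expand_det_row _ 0) !big_ord_recl big_ord0 /cofactor !det_mx11.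
rewrite !mxE /=.
have -> : lift 0 0 = 1 :> 'I_2 by apply: val_inj.
have -> : lift 1 0 = 0 :> 'I_2 by apply: val_inj.
rewrite !(s0, s1) /= /bump /=; ring.
Qed.

Lemma dotvE (R : realType) (x y : 'cV[R]_2) :
  dotv x y = x 0 0 * y 0 0 + x 1 0 * y 1 0.
Proof.
rewrite /dotv !mxE !big_ord_recl big_ord0 !mxE addr0.
by have -> : lift 0 0 = 1 :> 'I_2 by apply: val_inj.
Qed.

Definition mono (R : realType) d (x : 'cV[R]_2) : 'cV[R]_d.+1 :=
  \col_i (x 0 0 ^+ (d - i) * x 1 0 ^+ i).

Definition bform (R : realType) d (h : 'rV[R]_d.+1) (x : 'cV[R]_2) : R :=
  (h *m mono d x) 0 0.

Lemma bformE (R : realType) d (h : 'rV[R]_d.+1) x :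
  bform h x = \sum_(i < d.+1) h 0 i * (x 0 0 ^+ (d - i) * x 1 0 ^+ i).
Proof. by rewrite /bform !mxE; apply: eq_bigr => i _; rewrite !mxE. Qed.

Lemma bform_sum (R : realType) d (I : finType) (P : pred I) (c : I -> R)
    (h : I -> 'rV[R]_d.+1) x :
  bform (\sum_(i | P i) c i *: h i) x = \sum_(i | P i) c i * bform (h i) x.
Proof.
rewrite /bform mulmx_suml summxE; apply: eq_bigr => i _.
by rewrite -scalemxAl !mxE.
Qed.

Lemma bformB (R : realType) d (g h : 'rV[R]_d.+1) x :
  bform (g - h) x = bform g x - bform h x.
Proof. by rewrite /bform mulmxBl !mxE. Qed.

Lemma bformZ (R : realType) d c (h : 'rV[R]_d.+1) x :
  bform (c *: h) x = c * bform h x.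
Proof. by rewrite /bform -scalemxAl !mxE. Qed.

(** Every test form used below is such a product: it is the simplest form with
    prescribed projective zeros. The coefficients come from multiplying out one
    linear factor at a time. *)
Lemma prod_det2_bform (R : realType) d (y : 'I_d -> 'cV[R]_2) :
  exists h : 'rV[R]_d.+1, forall x, bform h x = \prod_(i < d) det2 x (y i).
Proof.
suff [c [_ Ec]] : exists c : nat -> R, (forall i, (d < i)%N -> c i = 0) /\
    forall x : 'cV[R]_2,
      \sum_(i < d.+1) c i * (x 0 0 ^+ (d - i) * x 1 0 ^+ i) =
      \prod_(i < d) det2 x (y i).
  exists (\row_i c i) => x; rewrite bformE -Ec.
  by apply: eq_bigr => i _; rewrite !mxE.
elim: d y => [|d IHd] y.
  exists (fun i => (i == 0%N)%:R); split=> [[]//|x].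
  by rewrite big_ord_recl !big_ord0 /=; ring.
have [c [c0 Ec]] := IHd (fun i => y (lift 0 i)).
pose u := y 0 0 0; pose v := y 0 1 0.
exists (fun i => v * c i - u * (if i is j.+1 then c j else 0)); split.
  case=> // i lti; rewrite (c0 i) // (c0 i.+1) ?(ltnW lti) // !mulr0 subr0 //.
move=> x; rewrite [RHS]big_ord_recl -Ec det2E -/u -/v.
under eq_bigr => i _ do rewrite mulrBl.
rewrite sumrB big_ord_recr /= c0 // mulr0 mul0r addr0.
rewrite [X in _ - X]big_ord_recl /= mulr0 mul0r add0r mulrBl !mulr_sumr.
congr (_ - _); apply: eq_bigr => i _.
  by rewrite subSn ?leq_ord // exprS; ring.
by rewrite /bump /= add1n subSS exprS; ring.
Qed.

(** The Lagrange forms at the d + 1 points show that the evaluation matrix is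
    invertible: the matrix of their coefficients times the matrix of monomials
    is diagonal, with nonzero diagonal. *)
Lemma bform_eq0 (R : realType) d (h : 'rV[R]_d.+1) (y : 'I_d.+1 -> 'cV[R]_2) :
  (forall k l, k != l -> det2 (y k) (y l) != 0) ->
  (forall k, bform h (y k) = 0) -> h = 0.
Proof.
move=> indep hy0.
have /choice[L EL] k := prod_det2_bform (fun l => y (lift k l)).
pose W : 'M_d.+1 := \matrix_k L k; pose V : 'M_d.+1 := \matrix_(i, k) mono d (y k) i 0.
pose D : 'rV[R]_d.+1 := \row_k bform (L k) (y k).
have WV : W *m V = diag_mx D.
  apply/matrixP=> k l; rewrite !mxE.
  have -> : \sum_j W k j * V j l = bform (L k) (y l).
    by rewrite bformE; apply: eq_bigr => i _; rewrite !mxE.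
  have [->|neq] := eqVneq; first by rewrite mulr1n.
  rewrite mulr0n EL; have [j -> _] := unlift_some neq.
  by rewrite (bigD1 j) //= det2E; ring.
have uV : V \in unitmx.
  have : W *m V \in unitmx.
    rewrite WV unitmxE det_diag unitfE; apply/prodf_neq0 => k _.
    by rewrite mxE EL; apply/prodf_neq0 => j _; rewrite indep // neq_lift.
  by rewrite unitmx_mul => /andP[].
apply: (can_inj (mulmxK uV)); rewrite mul0mx.
apply/rowP=> k; rewrite !mxE -[RHS](hy0 k) bformE.
by apply: eq_bigr => i _; rewrite !mxE.
Qed.

(** Lagrange interpolation. Both sides are forms of degree d in x that agree at
    the d + 1 points y k. *)
Lemma interpolation (R : realType) d (h : 'rV[R]_d.+1)
    (y : 'I_d.+1 -> 'cV[R]_2) (x : 'cV[R]_2) :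
  (forall k l, k != l -> det2 (y k) (y l) != 0) ->
  bform h x = \sum_k bform h (y k) *
     \prod_(l < d) (det2 x (y (lift k l)) / det2 (y k) (y (lift k l))).
Proof.
move=> indep.
have /choice[L EL] k := prod_det2_bform (fun l => y (lift k l)).
pose g := \sum_k (bform h (y k) * \prod_(l < d) (det2 (y k) (y (lift k l)))^-1) *: L k.
suff /subr0_eq E : h - g = 0.
  rewrite [in LHS]E /g bform_sum; apply: eq_bigr => k _.
  rewrite EL -mulrA -big_split /=; congr (_ * _); apply: eq_bigr => l _.
  exact: mulrC.
apply: (bform_eq0 indep) => k; rewrite bformB /g bform_sum (bigD1 k) //=.
rewrite EL -mulrA -big_split /= [X in _ * X]big1 => [|l _]; last first.
  by rewrite mulVf // indep // neq_lift.
rewrite big1 ?addr0 ?mulr1 ?subrr // => l neq.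
have [j Ek _] := unlift_some neq.
by rewrite EL [X in _ * X](bigD1 j) //= -Ek det2E; ring.
Qed.

(** * Minimal infeasible systems of strict linear inequalities *)

Definition feasible (R : realType) m (I : finType) (v : I -> 'cV[R]_m)
    (S : {set I}) : Prop :=
  exists h : 'rV[R]_m, forall k, k \in S -> 0 < (h *m v k) 0 0.

Definition min_infeasible (R : realType) m (I : finType) (v : I -> 'cV[R]_m)
    (S : {set I}) : Prop :=
  ~ feasible v S /\ forall k, k \in S -> feasible v (S :\ k).

Lemma infeasible_min (R : realType) m (I : finType) (v : I -> 'cV[R]_m)
    (S0 : {set I}) :
  ~ feasible v S0 -> exists2 S : {set I}, S \subset S0 & min_infeasible v S.
Proof.
move=> inf0.
have [|S /minsetP[/asboolP infS minS] sub] :=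
  @minset_exists I (fun S => `[< ~ feasible v S >]) S0; first exact/asboolP.
exists S => //; split=> // k kS; apply: contrapT => infSk.
have /setP/(_ k) := minS (S :\ k) (introT (asboolP _) infSk) (subsetDl _ _).
by rewrite !inE eqxx kS.
Qed.

(** If a weak solution were strict at k, adding a small multiple of a strict
    solution of the system without k would solve the whole system strictly. *)
Lemma weak_solution_eq0 (R : realType) m (I : finType) (v : I -> 'cV[R]_m)
    (S : {set I}) (h : 'rV[R]_m) :
  min_infeasible v S -> (forall k, k \in S -> 0 <= (h *m v k) 0 0) ->
  forall k, k \in S -> (h *m v k) 0 0 = 0.
Proof.
move=> [infS minS] h_ge0 k kS; apply/eqP/negP => /negP hk_neq0; apply: infS.
have hk_gt0 : 0 < (h *m v k) 0 0 by rewrite lt_def hk_neq0 h_ge0.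
have [g g_gt0] := minS k kS.
pose c := `|(g *m v k) 0 0| + 1.
exists (c *: h + (h *m v k) 0 0 *: g) => l lS.
have -> : ((c *: h + (h *m v k) 0 0 *: g) *m v l) 0 0 =
  c * (h *m v l) 0 0 + (h *m v k) 0 0 * (g *m v l) 0 0.
  by rewrite mulmxDl -!scalemxAl !mxE.
have c_gt0 : 0 < c by rewrite ltr_wpDl.
have [->|neq] := eqVneq l k.
  rewrite mulrC -mulrDr mulr_gt0 // /c.
  by have := lerNnormlW (lexx `|(g *m v k) 0 0|); lra.
by rewrite ltr_wpDl ?mulr_gt0 ?g_gt0 ?mulr_ge0 ?h_ge0 ?(ltW c_gt0) // !inE neq.
Qed.

(** Helly's theorem for open half-spaces, by Radon's argument. Let g k solve the
    system without k strictly. Were there at least m + 2 inequalities, some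
    nontrivial linear relation between the g k would have coefficient 0 at a
    chosen index i0. Moving its negative terms to the other side writes one
    vector hp in two ways as a nonnegative combination of the g k, and each
    inequality holds weakly at hp by one of the two. So hp is a weak solution,
    yet it is strict at i0. *)
Lemma min_infeasible_card (R : realType) m (I : finType) (v : I -> 'cV[R]_m)
    (S : {set I}) :
  min_infeasible v S -> (#|S| <= m.+1)%N.
Proof.
move=> minS; rewrite leqNgt; apply/negP => lt_mS.
have /choice[g g_gt0] (k : I) : exists g : 'rV[R]_m, k \in S ->
    forall l, l \in S -> l != k -> 0 < (g *m v l) 0 0.
  have [kS|/negP kS] := boolP (k \in S); last by exists 0.
  have [g g_gt0] := minS.2 k kS; exists g => _ l lS neq.
  by apply: g_gt0; rewrite !inE neq.
have S_gt0 : (0 < #|S|)%N by apply: leq_trans lt_mS.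
(* The first column of W forces a relation to have coefficient 0 at i0. *)
pose i0 : 'I_#|S| := Ordinal S_gt0.
pose G := \matrix_(k < #|S|) g (enum_val k).
pose W : 'M[R]_(#|S|, 1 + m) := row_mx (delta_mx i0 0) G.
have : kermx W != 0.
  rewrite -mxrank_eq0 mxrank_ker subn_eq0 -ltnNge.
  exact: leq_ltn_trans (rank_leq_col W) lt_mS.
case/rowV0Pn => c0 /sub_kermxP c0W c0_neq0.
have [c [cW [i1 ci1]]] : exists c : 'rV_#|S|, c *m W = 0 /\ exists i, 0 < c 0 i.
  have /rV0Pn[i ci] := c0_neq0.
  have [lt0|gt0|eq0] := ltgtP 0 (c0 0 i); last by rewrite -eq0 eqxx in ci.
    by exists c0; split=> //; exists i.
  by exists (- c0); split; [rewrite mulNmx c0W oppr0 | exists i; rewrite mxE oppr_gt0].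
move: cW; rewrite mul_mx_row => /eqP; rewrite row_mx_eq0 => /andP[/eqP c_i0 /eqP cG].
have {}c_i0 : c 0 i0 = 0.
  move/matrixP/(_ 0 0): c_i0; rewrite !mxE (bigD1 i0) //= big1 => [|i /negPf neq].
    by rewrite mxE !eqxx mulr1 addr0.
  by rewrite mxE neq mulr0.
pose hp := \sum_(k | 0 < c 0 k) c 0 k *: g (enum_val k).
have hpN : hp = \sum_(k | ~~ (0 < c 0 k)) (- c 0 k) *: g (enum_val k).
  apply/eqP; rewrite -subr_eq0 -sumrN -[X in _ == X]cG mulmx_sum_row.
  rewrite [X in _ == X](bigID (fun k => 0 < c 0 k)) /=; apply/eqP.
  by congr (_ + _); apply: eq_bigr => k _; rewrite rowK // scaleNr opprK.
have val (P : pred 'I_#|S|) (b : 'I_#|S| -> R) l :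
    ((\sum_(k | P k) b k *: g (enum_val k)) *m v l) 0 0 =
    \sum_(k | P k) b k * (g (enum_val k) *m v l) 0 0.
  rewrite mulmx_suml summxE; apply: eq_bigr => k _.
  by rewrite -scalemxAl mxE.
have ge0 (j : 'I_#|S|) : 0 <= (hp *m v (enum_val j)) 0 0.
  have [cj|/negPf cj] := boolP (0 < c 0 j).
    rewrite hpN val sumr_ge0 // => k ck.
    rewrite mulr_ge0 ?oppr_ge0 ?leNgt // -leNgt ltW // g_gt0 ?enum_valP //.
    by apply: contraNneq ck => /enum_val_inj <-.
  rewrite val sumr_ge0 // => k ck.
  rewrite mulr_ge0 ?ltW // g_gt0 ?enum_valP //.
  by apply: contraTneq ck => /enum_val_inj <-; rewrite cj.
have hp0 := weak_solution_eq0 minS (h := hp) _ (enum_valP i0).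
suff : 0 < (hp *m v (enum_val i0)) 0 0.
  rewrite hp0 ?ltxx // => k kS.
  by have := ge0 (enum_rank_in kS k); rewrite enum_rankK_in.
rewrite val (bigD1 i1) //= ltr_wpDr //.
  apply: sumr_ge0 => k /andP[ck _].
  rewrite mulr_ge0 ?ltW // g_gt0 ?enum_valP //.
  by apply: contraTneq ck => /enum_val_inj <-; rewrite c_i0 ltxx.
rewrite mulr_gt0 // g_gt0 ?enum_valP //.
by apply: contraTneq ci1 => /enum_val_inj <-; rewrite c_i0 ltxx.
Qed.

(** * Separating points of the projective line by forms *)

(** For d + 2 pairwise independent points, half of each kind, this says that the
    two kinds alternate on the projective line. It is stated through the
    weakly separating forms rather than through an order on that line. *)
Definition sign_rigid (R : realType) n d (a c : 'I_n -> 'cV[R]_2) : Prop :=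
  forall h : 'rV[R]_d.+1,
    (forall k, 0 <= bform h (a k)) -> (forall l, bform h (c l) <= 0) ->
    (forall k, bform h (a k) = 0) /\ (forall l, bform h (c l) = 0).

Lemma exists_det2_neq0 (R : realType) (x : 'cV[R]_2) :
  x != 0 -> exists y, det2 x y != 0.
Proof.
move=> x_neq0; have [x0|x0] := eqVneq (x 0 0) 0.
  exists (\col_i (i == 0)%:R); rewrite det2E !mxE /= mulr0 mulr1 add0r oppr_eq0.
  apply: contraNneq x_neq0 => x1; apply/eqP/matrixP=> i j.
  by rewrite ord1 mxE; case: (ord2P i) => ->.
by exists (\col_i (i == 1)%:R); rewrite det2E !mxE /= mulr0 mulr1 subr0.
Qed.

Section Alternation.
Variables (R : realType) (I : finType) (x : I -> 'cV[R]_2) (s : I -> bool).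

Let v d k : 'cV[R]_d.+1 := (-1 : R) ^+ (~~ s k) *: mono d (x k).

Let vE d (h : 'rV[R]_d.+1) k :
  (h *m v d k) 0 0 = (-1) ^+ (~~ s k) * bform h (x k).
Proof. by rewrite /v -scalemxAr mxE. Qed.

(** The product of the squared linear forms vanishing at the points of sign b, if
    there are at most n of them, is a weak solution once its own sign is chosen.
    It is strict at each point of the other sign, and weak solutions of a
    minimal infeasible system are never strict. *)
Let few_of_one_sign n (S : {set I}) (b : bool) :
  min_infeasible (v (n + n)) S ->
  (forall k, k \in S -> x k != 0) ->
  (forall k l, k \in S -> l \in S -> k != l -> det2 (x k) (x l) != 0) ->
  (#|[set k in S | s k == b]| <= n)%N ->
  forall l, l \in S -> s l = b.
Proof.
move=> minS x_neq0 indep few l lS; apply/eqP/contraT => neq_b.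
have {neq_b} sl : s l = ~~ b by case: (s l) neq_b; case: (b).
have [y ly_neq0] := exists_det2_neq0 (x_neq0 l lS).
pose B := [set k in S | s k == b].
(* The default value y pads the list of roots to length n; it is not
   proportional to x l, so the test form does not vanish at x l. *)
pose z (i : 'I_n) := nth y [seq x k | k in B] i.
pose z2 (i : 'I_(n + n)) := match split i with inl j => z j | inr j => z j end.
have [h Eh] := prod_det2_bform z2.
have {}Eh w : bform h w = (\prod_(i < n) det2 w (z i)) ^+ 2.
  rewrite Eh big_split_ord expr2; congr (_ * _); apply: eq_bigr => i _.
    by rewrite /z2 (unsplitK (inl i)).
  by rewrite /z2 (unsplitK (inr i)).
pose g := (-1) ^+ b *: h.
have gE k : (g *m v _ k) 0 0 = (-1) ^+ (s k == b) * (\prod_(i < n) det2 (x k) (z i)) ^+ 2.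
  rewrite vE /g /bform -scalemxAl mxE mulrA -signr_addb -/(bform h (x k)) Eh.
  by case: (s k); case: (b).
have zB k : k \in B -> exists i, z i = x k.
  move=> kB; have lti : (index (x k) [seq x k | k in B] < n)%N.
    apply: leq_trans few; rewrite -/B -(size_image x) index_mem.
    exact: image_f.
  by exists (Ordinal lti); rewrite /z nth_index // image_f.
have g_ge0 k : k \in S -> 0 <= (g *m v _ k) 0 0.
  rewrite gE => kS; have [skb|] := eqVneq (s k) b; last by rewrite mul1r sqr_ge0.
  have [|i zi] := zB k; first by rewrite inE kS skb /=.
  by rewrite (bigD1 i) //= zi det2E mulrC [x k 0 0 * _]mulrC subrr mul0r expr0n mul0r.
have := weak_solution_eq0 minS g_ge0 lS.
rewrite gE sl; have -> : (~~ b == b) = false by case: (b).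
rewrite mul1r => /eqP; rewrite expf_eq0 /= => /prodf_eq0[i _].
rewrite /z; have [lti|gei] := ltnP i (size [seq x k | k in B]); last first.
  by rewrite nth_default // (negPf ly_neq0).
have /imageP[k kB ->] := mem_nth y lti.
move: kB; rewrite inE => /andP[kS /eqP sk]; rewrite (negPf (indep _ _ lS kS _)) //.
by apply/eqP => Elk; move: sl; rewrite Elk sk; case: (b).
Qed.

(** A form of degree 2n has 2n + 1 coefficients, so a minimal obstruction to
    separation involves at most 2n + 2 points. By the previous lemma it contains
    at least n + 1 points of each sign, hence exactly n + 1 of each. *)
Theorem separation_or_alternation n (S0 : {set I}) :
  (forall k, k \in S0 -> x k != 0) ->
  (forall k l, k \in S0 -> l \in S0 -> k != l -> det2 (x k) (x l) != 0) ->
  (exists h : 'rV[R]_(n + n).+1, forall k, k \in S0 ->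
     if s k then 0 < bform h (x k) else bform h (x k) < 0) \/
  (exists f g : 'I_n.+1 -> I,
    [/\ injective f, injective g,
        forall k, f k \in S0 /\ s (f k), forall l, g l \in S0 /\ s (g l) = false
      & sign_rigid (n + n) (x \o f) (x \o g)]).
Proof.
move=> x_neq0 indep.
have [feas|infeas] := pselect (feasible (v (n + n)) S0).
  left; have [h h_gt0] := feas; exists h => k /h_gt0; rewrite vE.
  by case: (s k); rewrite ?mul1r // mulN1r oppr_gt0.
right; have [S /subsetP subS minS] := infeasible_min infeas.
have [l0 l0S] : exists l, l \in S.
  apply/set0Pn/negP => /eqP S0_eq; apply: minS.1.
  by exists 0 => k; rewrite S0_eq inE.
pose B b := [set k in S | s k == b].
have cardB b : (n < #|B b|)%N.
  have few b' := @few_of_one_sign n S b' minS (fun k kS => x_neq0 k (subS k kS))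
    (fun k l kS lS => indep k l (subS k kS) (subS l lS)).
  have nonempty : (n < #|B (~~ b)|)%N -> (n < #|B b|)%N.
    move=> lt_n; rewrite ltnNge; apply/negP => /few all_b.
    have /card_gt0P[k] : (0 < #|B (~~ b)|)%N by apply: leq_trans lt_n.
    by rewrite inE => /andP[/all_b -> /eqP]; case: (b).
  have [//|le_n] := ltnP n #|B b|.
  suff: (n < #|B b|)%N by rewrite ltnNge le_n.
  apply: nonempty; rewrite ltnNge; apply/negP => /few all_nb.
  have := few b le_n l0 l0S; rewrite all_nb //; by case: (b).
have sumB : (#|B true| + #|B false|)%N = #|S|.
  rewrite -(cardsID (B true) S); congr (_ + _)%N; apply: eq_card => k.
    by rewrite !inE andbA andbb.
  by rewrite !inE; case: (k \in S) (s k) => [] [].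
have cardS := min_infeasible_card minS.
have {sumB cardS} cardB1 b : #|B b| = n.+1.
  apply/eqP; rewrite eqn_leq cardB andbT.
  have := cardB (~~ b); move: cardS; rewrite -sumB.
  case: b => /= le1 le2.
    rewrite -(leq_add2r n.+1) (leq_trans (leq_add (leqnn _) le2)) //.
    by rewrite (leq_trans le1) // addnS.
  rewrite -(leq_add2l n.+1) (leq_trans (leq_add le2 (leqnn _))) //.
  by rewrite (leq_trans le1) // addnS.
pose f b (k : 'I_n.+1) := enum_val (cast_ord (esym (cardB1 b)) k).
have fB b k : f b k \in S /\ s (f b k) = b.
  by have := enum_valP (cast_ord (esym (cardB1 b)) k); rewrite inE => /andP[? /eqP].
have f_inj b : injective (f b).
  by move=> k l /enum_val_inj /cast_ord_inj.
have f_onto k : k \in S -> exists i, f (s k) i = k.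
  move=> kS; have kB : k \in B (s k) by rewrite inE kS /=.
  exists (cast_ord (cardB1 _) (enum_rank_in kB k)).
  by rewrite /f cast_ordK enum_rankK_in.
exists (f true), (f false); split=> // [k|l|h h_ge0 h_le0].
- by have [/subS ? ->] := fB true k.
- by have [/subS ? ->] := fB false l.
have h0 : forall k, k \in S -> (h *m v _ k) 0 0 = 0.
  apply: (weak_solution_eq0 minS) => k kS; rewrite vE.
  have [i <-] := f_onto k kS; have [_ ->] := fB (s k) i.
  by case: (s k); [rewrite mul1r h_ge0|rewrite mulN1r oppr_ge0 h_le0].
split=> k.
  by have [kS sk] := fB true k; have := h0 _ kS; rewrite vE sk mul1r.
have [kS sk] := fB false k; have := h0 _ kS.
by rewrite vE sk mulN1r => /eqP; rewrite oppr_eq0 => /eqP.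
Qed.
End Alternation.

(** * The sign system as alternation of points *)

(** Since dotv a b = det2 a (perp b), the points a and perp b of the projective
    line coincide exactly when a and b are orthogonal. The matrix
    perp b (perp b)^T spans the ray along which the plane orthogonal to b b^T
    touches the psd cone. *)
Definition perp (R : realType) (b : 'cV[R]_2) : 'cV[R]_2 :=
  \col_i (if i == 0 then - b 1 0 else b 0 0).

Lemma det2_perpr (R : realType) (a b : 'cV[R]_2) : det2 a (perp b) = dotv a b.
Proof. by rewrite det2E dotvE !mxE /=; ring. Qed.

Lemma det2_perp (R : realType) (b b' : 'cV[R]_2) :
  det2 (perp b) (perp b') = det2 b b'.
Proof. by rewrite !det2E !mxE /=; ring. Qed.

Lemma det2_perpl (R : realType) (a b : 'cV[R]_2) :
  det2 (perp b) a = - dotv a b.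
Proof. by rewrite det2E dotvE !mxE /=; ring. Qed.

Lemma det2C (R : realType) (x y : 'cV[R]_2) : det2 x y = - det2 y x.
Proof. by rewrite !det2E; ring. Qed.

Lemma det2xx (R : realType) (x : 'cV[R]_2) : det2 x x = 0.
Proof. by rewrite !det2E; ring. Qed.

Lemma ord3P (i : 'I_3) : [\/ i = 0, i = 1 | i = 2].
Proof.
case: i => [[|[|[|?]]]] // ?;
  [apply: Or31|apply: Or32|apply: Or33]; exact: val_inj.
Qed.

Lemma quartic4 (R : realType) (y1 y2 y3 y4 : 'cV[R]_2) :
  exists h : 'rV[R]_5, forall x,
    bform h x = det2 x y1 * det2 x y2 * det2 x y3 * det2 x y4.
Proof.
have [h Eh] := prod_det2_bform (fun i : 'I_4 => nth y1 [:: y1; y2; y3; y4] i).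
by exists h => x; rewrite Eh !big_ord_recl big_ord0 /= mulr1 ?mulrA.
Qed.

Lemma quadratic2 (R : realType) (y1 y2 : 'cV[R]_2) :
  exists h : 'rV[R]_3, forall x, bform h x = det2 x y1 * det2 x y2.
Proof.
have [h Eh] := prod_det2_bform (fun i : 'I_2 => nth y1 [:: y1; y2] i).
by exists h => x; rewrite Eh !big_ord_recl big_ord0 /= mulr1 ?mulrA.
Qed.

Lemma bformN (R : realType) d (h : 'rV[R]_d.+1) x : bform (- h) x = - bform h x.
Proof. by rewrite -scaleN1r bformZ mulN1r. Qed.

(** If the two values had opposite signs, h or its opposite would separate the
    points weakly without vanishing at all of them. *)
Lemma sign_rigid_opp (R : realType) n d (a c : 'I_n -> 'cV[R]_2)
    (h : 'rV[R]_d.+1) k l :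
  sign_rigid d a c ->
  (forall k', k' != k -> bform h (a k') = 0) ->
  (forall l', l' != l -> bform h (c l') = 0) ->
  0 <= bform h (a k) * bform h (c l).
Proof.
move=> rig a0 c0; rewrite leNgt; apply/negP => lt0.
have [h_gt0|h_lt0|h0] := ltgtP 0 (bform h (a k)); last by rewrite -h0 mul0r ltxx in lt0.
  have hc : bform h (c l) < 0 by rewrite -(pmulr_rlt0 _ h_gt0).
  have [||/(_ k) h0 _] := rig h; last by rewrite h0 ltxx in h_gt0.
    by move=> k'; have [->|/a0->//] := eqVneq k' k; apply: ltW.
  by move=> l'; have [->|/c0->//] := eqVneq l' l; apply: ltW.
have hc : 0 < bform h (c l) by rewrite -(nmulr_rlt0 _ h_lt0).
have [||/(_ k) h0 _] := rig (- h); last by rewrite bformN in h0; lra.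
  move=> k'; rewrite bformN oppr_ge0.
  by have [->|/a0->//] := eqVneq k' k; apply: ltW.
move=> l'; rewrite bformN oppr_le0.
by have [->|/c0->//] := eqVneq l' l; apply: ltW.
Qed.

(** Values of the same sign at two points of one kind would make h or its opposite
    a weakly separating form that does not vanish at these points. *)
Lemma sign_rigid_same (R : realType) n d (a c : 'I_n -> 'cV[R]_2)
    (h : 'rV[R]_d.+1) l1 l2 :
  sign_rigid d a c -> (forall k, bform h (a k) = 0) ->
  (forall l', l' != l1 -> l' != l2 -> bform h (c l') = 0) ->
  bform h (c l1) * bform h (c l2) <= 0.
Proof.
move=> rig a0 c0; rewrite leNgt; apply/negP => gt0.
have [h_gt0|h_lt0|h0] := ltgtP 0 (bform h (c l1)); last by rewrite -h0 mul0r ltxx in gt0.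
  have hc : 0 < bform h (c l2) by rewrite -(pmulr_rgt0 _ h_gt0).
  have [||_ /(_ l1) h0] := rig (- h); last by rewrite bformN in h0; lra.
    by move=> k; rewrite bformN a0 oppr0.
  move=> l'; rewrite bformN oppr_le0.
  have [->|n1] := eqVneq l' l1; first exact: ltW.
  by have [->|/c0->//] := eqVneq l' l2; apply: ltW.
have hc : bform h (c l2) < 0 by rewrite -(nmulr_rgt0 _ h_lt0).
have [||_ /(_ l1) h0] := rig h; last by rewrite h0 ltxx in h_lt0.
  by move=> k; rewrite a0.
move=> l'; have [->|n1] := eqVneq l' l1; first exact: ltW.
by have [->|/c0->//] := eqVneq l' l2; apply: ltW.
Qed.

Lemma div_ge0_mul (R : realType) (x y : R) : 0 <= x * y -> 0 <= x / y.
Proof.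
move=> xy; have [->|y0] := eqVneq y 0; first by rewrite invr0 mulr0.
have -> : x / y = x * y * y^-1 ^+ 2 by field.
by rewrite mulr_ge0 // sqr_ge0.
Qed.

(** Each inequality compares one of the points with perp (b 2): evaluate, at these
    two points, the product of the linear forms vanishing at the other four. The
    numerator of the ratio is, up to sign, the value at the first point, and the
    denominator is the value at perp (b 2). *)
Lemma rigid_sign_system (R : realType) (a b : 'I_3 -> 'cV[R]_2) :
  sign_rigid 4 a (fun l => perp (b l)) -> sign_system a b.
Proof.
move=> rig.
pose pr y1 y2 y3 y4 (x : 'cV[R]_2) := det2 x y1 * det2 x y2 * det2 x y3 * det2 x y4.
have ac y1 y2 y3 y4 k l :
    (forall k', k' != k -> pr y1 y2 y3 y4 (a k') = 0) ->
    (forall l', l' != l -> pr y1 y2 y3 y4 (perp (b l')) = 0) ->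
    0 <= pr y1 y2 y3 y4 (a k) * pr y1 y2 y3 y4 (perp (b l)).
  have [h Eh] := quartic4 y1 y2 y3 y4; rewrite /pr -!Eh => H1 H2.
  by apply: (sign_rigid_opp rig) => k'; rewrite Eh; [apply: H1|apply: H2].
have cc y1 y2 y3 y4 l1 l2 :
    (forall k, pr y1 y2 y3 y4 (a k) = 0) ->
    (forall l', l' != l1 -> l' != l2 -> pr y1 y2 y3 y4 (perp (b l')) = 0) ->
    pr y1 y2 y3 y4 (perp (b l1)) * pr y1 y2 y3 y4 (perp (b l2)) <= 0.
  have [h Eh] := quartic4 y1 y2 y3 y4; rewrite /pr -!Eh => H1 H2.
  by apply: (sign_rigid_same rig) => k'; rewrite Eh; [apply: H1|apply: H2].
have t1 := ac (a 1) (a 2) (perp (b 0)) (perp (b 1)) 0 2.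
have t2 := ac (a 0) (a 2) (perp (b 0)) (perp (b 1)) 1 2.
have t3 := ac (a 0) (a 1) (perp (b 0)) (perp (b 1)) 2 2.
have t4 := cc (a 0) (a 1) (a 2) (perp (b 1)) 0 2.
have t5 := cc (a 0) (a 1) (a 2) (perp (b 0)) 1 2.
have geE (x y : R) : 0 <= x -> x = y -> 0 <= y by move=> + <-.
split; rewrite -?mulNr; apply: div_ge0_mul.
- have: 0 <= pr (a 1) (a 2) (perp (b 0)) (perp (b 1)) (a 0) *
    pr (a 1) (a 2) (perp (b 0)) (perp (b 1)) (perp (b 2)).
    by apply: t1 => k; case: (ord3P k) => -> // _; rewrite /pr ?det2xx !(mulr0, mul0r).
  rewrite /pr !det2_perp !det2_perpl !det2_perpr.
  by rewrite (det2C (b 2)) (det2C (b 2) (b 1)) => /geE; apply; ring.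
- have: 0 <= pr (a 0) (a 2) (perp (b 0)) (perp (b 1)) (a 1) *
    pr (a 0) (a 2) (perp (b 0)) (perp (b 1)) (perp (b 2)).
    by apply: t2 => k; case: (ord3P k) => -> // _; rewrite /pr ?det2xx !(mulr0, mul0r).
  rewrite /pr !det2_perp !det2_perpl !det2_perpr (det2C (a 1) (a 0)).
  by rewrite (det2C (b 2)) (det2C (b 2) (b 1)) => /geE; apply; ring.
- have: 0 <= pr (a 0) (a 1) (perp (b 0)) (perp (b 1)) (a 2) *
    pr (a 0) (a 1) (perp (b 0)) (perp (b 1)) (perp (b 2)).
    by apply: t3 => k; case: (ord3P k) => -> // _; rewrite /pr ?det2xx !(mulr0, mul0r).
  rewrite /pr !det2_perp !det2_perpl !det2_perpr (det2C (a 2) (a 0)) (det2C (a 2) (a 1)).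
  by rewrite (det2C (b 2)) (det2C (b 2) (b 1)) => /geE; apply; ring.
- have: pr (a 0) (a 1) (a 2) (perp (b 1)) (perp (b 0)) *
    pr (a 0) (a 1) (a 2) (perp (b 1)) (perp (b 2)) <= 0.
    by apply: t4 => k; case: (ord3P k) => -> // *; rewrite /pr ?det2xx !(mulr0, mul0r).
  rewrite -oppr_ge0 /pr !det2_perp !det2_perpl.
  by rewrite (det2C (b 2) (b 1)) => /geE; apply; ring.
- have: pr (a 0) (a 1) (a 2) (perp (b 0)) (perp (b 1)) *
    pr (a 0) (a 1) (a 2) (perp (b 0)) (perp (b 2)) <= 0.
    by apply: t5 => k; case: (ord3P k) => -> // *; rewrite /pr ?det2xx !(mulr0, mul0r).
  rewrite -oppr_ge0 /pr !det2_perp !det2_perpl.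
  by rewrite (det2C (b 2)) (det2C (b 1) (b 0)) => /geE; apply; ring.
Qed.

(** The five ratios of the system are, up to sign, the inverses of the Lagrange
    weights that express the value of a quartic at perp (b 2) through its values
    at the other five points. With the signs prescribed by the system, the value
    there of a weakly separating quartic is both nonpositive and a sum of
    nonnegative terms. So the quartic vanishes at the five points, hence
    identically. *)
Lemma sign_system_rigid (R : realType) (a b : 'I_3 -> 'cV[R]_2) (h : 'rV[R]_5) :
  (forall k l, k != l -> det2 (a k) (a l) != 0) ->
  (forall k l, k != l -> det2 (b k) (b l) != 0) ->
  (forall k l, dotv (a k) (b l) != 0) ->
  sign_system a b ->
  (forall k, 0 <= bform h (a k)) -> (forall l, bform h (perp (b l)) <= 0) ->
  h = 0.
Proof.
move=> det_a det_b dot_ab [s1 s2 s3 s4 s5] ha hb.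
pose y (k : 'I_5) := nth 0 [:: a 0; a 1; a 2; perp (b 0); perp (b 1)] k.
have indep k l : k != l -> det2 (y k) (y l) != 0.
  by case: k => [[|[|[|[|[|?]]]]] ?] //; case: l => [[|[|[|[|[|?]]]]] ?] // _;
    rewrite /y /= ?det2_perp ?det2_perpl ?det2_perpr ?oppr_eq0 ?det_a ?det_b ?dot_ab.
have := interpolation h (perp (b 2)) indep.
rewrite !big_ord_recl !big_ord0 /y /= !mulr1 !addr0.
rewrite !det2_perp !det2_perpl !det2_perpr.
rewrite (det2C (a 1) (a 0)) (det2C (a 2) (a 0)) (det2C (a 2) (a 1)).
rewrite (det2C (b 1) (b 0)) (det2C (b 2) (b 0)) (det2C (b 2) (b 1)).
have [[dA01 dA02] dA12] := (det_a 0 1 isT, det_a 0 2 isT, det_a 1 2 isT).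
have [[dB01 dB02] dB12] := (det_b 0 1 isT, det_b 0 2 isT, det_b 1 2 isT).
set r1 := _ / _ in s1; set r2 := - _ in s2; set r3 := _ / _ in s3.
set r4 := _ / _ in s4; set r5 := - _ in s5.
have pos (r : R) : 0 <= r -> r != 0 -> 0 < r^-1.
  by move=> *; rewrite invr_gt0 lt_def; apply/andP.
have {}s1 : 0 < r1^-1.
  by apply: (pos _ s1); rewrite !(mulf_neq0, invr_neq0) ?dot_ab.
have {}s2 : 0 < r2^-1.
  by apply: (pos _ s2); rewrite oppr_eq0 !(mulf_neq0, invr_neq0) ?dot_ab.
have {}s3 : 0 < r3^-1.
  by apply: (pos _ s3); rewrite !(mulf_neq0, invr_neq0) ?dot_ab.
have {}s4 : 0 < r4^-1.
  by apply: (pos _ s4); rewrite !(mulf_neq0, invr_neq0) ?dot_ab.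
have {}s5 : 0 < r5^-1.
  by apply: (pos _ s5); rewrite oppr_eq0 !(mulf_neq0, invr_neq0) ?dot_ab.
set P1 := - _ / _ * _; set P2 := - _ / - _ * _; set P3 := - _ / - _ * _.
set P4 := - dotv (a 0) (b 2) / - dotv (a 0) (b 0) * _.
set P5 := - dotv (a 0) (b 2) / - dotv (a 0) (b 1) * _.
have -> : P1 = r1^-1 by rewrite /P1 /r1; field; rewrite !dot_ab dA01 dA02 dB02 dB12.
have -> : P2 = r2^-1 by rewrite /P2 /r2; field; rewrite !dot_ab dA01 dA12 dB02 dB12.
have -> : P3 = r3^-1 by rewrite /P3 /r3; field; rewrite !dot_ab dA02 dA12 dB02 dB12.
have -> : P4 = - r4^-1 by rewrite /P4 /r4; field; rewrite !dot_ab dB01 dB12.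
have -> : P5 = - r5^-1 by rewrite /P5 /r5; field; rewrite !dot_ab dB01 dB02.
move=> E; have := hb 2; rewrite {}E.
have t1 := mulr_ge0 (ha 0) (ltW s1); have t2 := mulr_ge0 (ha 1) (ltW s2).
have t3 := mulr_ge0 (ha 2) (ltW s3).
have t4 := mulr_le0_ge0 (hb 0) (ltW s4); have t5 := mulr_le0_ge0 (hb 1) (ltW s5).
rewrite !mulrN => le0.
have z (u v : R) : 0 < v -> u * v = 0 -> u = 0.
  by move=> v0 /eqP; rewrite mulf_eq0 (gt_eqF v0) orbF => /eqP.
apply: (bform_eq0 indep) => -[[|[|[|[|[|?]]]]] ?] //; rewrite /y /=.
- by apply: (z _ _ s1); lra.
- by apply: (z _ _ s2); lra.
- by apply: (z _ _ s3); lra.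
- by apply: (z _ _ s4); lra.
- by apply: (z _ _ s5); lra.
Qed.

(** When a 0 and perp (b 0) are the same projective point, the first and fourth
    ratios vanish. Each of the other three is, up to a nonnegative factor, the
    product of the values that a product of two linear forms takes at two of the
    four remaining points, or the opposite of it; alternation of these four
    points for quadratic forms determines its sign. *)
Lemma rigid_sign_system_tangent (R : realType) (a b : 'I_3 -> 'cV[R]_2) (t : R) :
  perp (b 0) = t *: a 0 ->
  sign_rigid 2 (fun k : 'I_2 => a (lift 0 k)) (fun l : 'I_2 => perp (b (lift 0 l))) ->
  sign_system a b.
Proof.
move=> Eb rig.
have lift0 : lift 0 0 = 1 :> 'I_3 by apply: val_inj.
have lift1 : lift 0 1 = 2 :> 'I_3 by apply: val_inj.
have dot0 k : dotv (a k) (b 0) = t * det2 (a k) (a 0).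
  by rewrite -det2_perpr Eb !det2E !mxE; ring.
have det0 l : det2 (b 0) (b l) = t * dotv (a 0) (b l).
  by rewrite -det2_perp Eb -det2_perpr !det2E !mxE; ring.
pose pr y1 y2 (x : 'cV[R]_2) := det2 x y1 * det2 x y2.
have ac y1 y2 (k l : 'I_2) :
    (forall k', k' != k -> pr y1 y2 (a (lift 0 k')) = 0) ->
    (forall l', l' != l -> pr y1 y2 (perp (b (lift 0 l'))) = 0) ->
    0 <= pr y1 y2 (a (lift 0 k)) * pr y1 y2 (perp (b (lift 0 l))).
  have [h Eh] := quadratic2 y1 y2; rewrite /pr -!Eh => H1 H2.
  by apply: (sign_rigid_opp rig) => k'; rewrite Eh; [apply: H1|apply: H2].
have cc y1 y2 : (forall k, pr y1 y2 (a (lift 0 k)) = 0) ->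
    pr y1 y2 (perp (b (lift 0 0))) * pr y1 y2 (perp (b (lift 0 1))) <= 0.
  have [h Eh] := quadratic2 y1 y2; rewrite /pr -!Eh => H1.
  apply: (sign_rigid_same rig) => k'; rewrite Eh; first exact: H1.
  by case: (ord2P k') => ->; rewrite ?eqxx.
have t2 := ac (a 2) (perp (b 1)) 0 1.
have t3 := ac (a 1) (perp (b 1)) 1 1.
have t5 := cc (a 1) (a 2).
(* z ^ 2 is the factor between a product of two test values and the product of
   the numerator and denominator of a ratio. *)
have sqM (x y z : R) : 0 <= x -> y = z ^+ 2 * x -> 0 <= y.
  by move=> x0 ->; rewrite mulr_ge0 ?sqr_ge0.
have dot00 : dotv (a 0) (b 0) = 0 by rewrite dot0 det2xx mulr0.
split; rewrite -?mulNr; apply: div_ge0_mul.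
- by rewrite dot00 !(mulr0, mul0r).
- have := t2; rewrite !lift0 lift1 => /(_ _ _)/sqM; apply.
  + by move=> k; case: (ord2P k) => -> // _; rewrite lift1 /pr det2xx mul0r.
  + by move=> k; case: (ord2P k) => -> // _; rewrite lift0 /pr det2xx mulr0.
  rewrite /pr det2_perp det2_perpl det2_perpr dot0 det0.
  instantiate (1 := t * det2 (a 0) (a 1) * dotv (a 0) (b 2)).
  by rewrite (det2C (a 1) (a 0)) (det2C (b 2) (b 1)); ring.
- have := t3; rewrite !lift1 => /(_ _ _)/sqM; apply.
  + by move=> k; case: (ord2P k) => -> // _; rewrite lift0 /pr det2xx mul0r.
  + by move=> k; case: (ord2P k) => -> // _; rewrite lift0 /pr det2xx mulr0.
  rewrite /pr det2_perp det2_perpl det2_perpr dot0 det0.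
  instantiate (1 := t * det2 (a 0) (a 2) * dotv (a 0) (b 2)).
  by rewrite (det2C (a 2) (a 0)) (det2C (a 2) (a 1)) (det2C (b 2) (b 1)); ring.
- by rewrite dot00 !(mulr0, mul0r).
- have := t5; rewrite -oppr_ge0 lift0 lift1 => /(_ _)/sqM; apply.
    by move=> k; case: (ord2P k) => ->; rewrite ?lift0 ?lift1 /pr det2xx !(mulr0, mul0r).
  rewrite /pr !det2_perpl !det0.
  by instantiate (1 := t * dotv (a 0) (b 1) * dotv (a 0) (b 2)); ring.
Qed.

(** * Symmetric matrices of size 2 as vectors of a Lorentz space *)

Definition symv (R : realType) (A : 'M[R]_2) : 'rV[R]_3 :=
  \row_k nth 0 [:: A 0 0; A 0 1; A 1 1] k.

(** The coordinates of the adjugate of B. With this choice the trace pairing of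
    two symmetric matrices becomes the polarization of the determinant, and the
    psd cone becomes its own dual in coordinates. *)
Definition adjv (R : realType) (B : 'M[R]_2) : 'rV[R]_3 :=
  \row_k nth 0 [:: B 1 1; - B 0 1; B 0 0] k.

Definition symm (R : realType) (u : 'rV[R]_3) : 'M[R]_2 :=
  \matrix_(i, j) nth 0 [:: u 0 0; u 0 1; u 0 2] (i + j).

Definition adjm (R : realType) (u : 'rV[R]_3) : 'M[R]_2 :=
  \matrix_(i, j) nth 0 [:: u 0 2; - u 0 1; u 0 0] (i + j).

Definition detv (R : realType) (u : 'rV[R]_3) : R := u 0 0 * u 0 2 - u 0 1 ^+ 2.

(** The bilinear form of signature (1, 2) with pairv u u = 2 detv u. *)
Definition pairv (R : realType) (u v : 'rV[R]_3) : R :=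
  u 0 0 * v 0 2 + u 0 2 * v 0 0 - 2 * u 0 1 * v 0 1.

Definition psdv (R : realType) (u : 'rV[R]_3) : Prop :=
  [/\ 0 <= u 0 0, 0 <= u 0 2 & 0 <= detv u].

Lemma sum2 (V : nmodType) (F : 'I_2 -> V) : \sum_i F i = F 0 + F 1.
Proof.
rewrite !big_ord_recl big_ord0 addr0.
by have -> : lift 0 0 = 1 :> 'I_2 by apply: val_inj.
Qed.

Lemma sum3 (V : nmodType) (F : 'I_3 -> V) : \sum_i F i = F 0 + F 1 + F 2.
Proof.
rewrite !big_ord_recl big_ord0 addr0 addrA.
have -> : lift 0 0 = 1 :> 'I_3 by apply: val_inj.
by have -> : lift 0 (lift 0 0) = 2 :> 'I_3 by apply: val_inj.
Qed.

Lemma row3P (R : realType) (u v : 'rV[R]_3) :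
  u 0 0 = v 0 0 -> u 0 1 = v 0 1 -> u 0 2 = v 0 2 -> u = v.
Proof. by move=> E0 E1 E2; apply/rowP => k; case: (ord3P k) => ->. Qed.

Lemma mx22P (R : realType) (A B : 'M[R]_2) :
  A 0 0 = B 0 0 -> A 0 1 = B 0 1 -> A 1 0 = B 1 0 -> A 1 1 = B 1 1 -> A = B.
Proof.
by move=> *; apply/matrixP => i j; case: (ord2P i) => ->; case: (ord2P j) => ->.
Qed.

Lemma quad_formE (R : realType) (A : 'M[R]_2) (x : 'cV[R]_2) :
  (x^T *m A *m x) 0 0 =
  A 0 0 * x 0 0 ^+ 2 + (A 0 1 + A 1 0) * x 0 0 * x 1 0 + A 1 1 * x 1 0 ^+ 2.
Proof. by rewrite !mxE sum2 !mxE !sum2 !mxE; ring. Qed.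

(** Nonnegativity of both diagonal entries and of the determinant follows from
    evaluating the quadratic form at the coordinate vectors, at the two columns
    of the adjugate and, when the diagonal vanishes, at (1, - A 0 1). *)
Lemma psdmxP (R : realType) (A : 'M[R]_2) :
  psdmx A <-> A 1 0 = A 0 1 /\ psdv (symv A).
Proof.
rewrite /psdmx /psdv /detv !mxE /=; split=> [[symA posA]|[symA [a0 a2 det_ge0]]].
  have E : A 1 0 = A 0 1 by rewrite -{1}symA mxE.
  have Q (u v : R) : 0 <= A 0 0 * u ^+ 2 + 2 * A 0 1 * u * v + A 1 1 * v ^+ 2.
    have := posA (\col_i nth 0 [:: u; v] i).
    rewrite quad_formE !mxE /= E => /le_trans -> //.
    by rewrite le_eqVlt; apply/orP; left; apply/eqP; ring.
  have q0 := Q 1 0; have q2 := Q 0 1; have q3 := Q (A 1 1) (- A 0 1).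
  have q4 := Q (A 0 1) (- A 0 0); have q5 := Q 1 (- A 0 1).
  have a0 : 0 <= A 0 0 by lra.
  have a2 : 0 <= A 1 1 by lra.
  split=> //; split=> //.
  have [z0|z0] := eqVneq (A 0 0) 0; last first.
    have p0 : 0 < A 0 0 by rewrite lt_def z0.
    by rewrite -(pmulr_rge0 _ p0); apply: (le_trans q4); nra.
  have [z2|z2] := eqVneq (A 1 1) 0; last first.
    have p0 : 0 < A 1 1 by rewrite lt_def z2.
    by rewrite -(pmulr_rge0 _ p0); apply: (le_trans q3); nra.
  by move: q5; rewrite z0 z2; nra.
split.
  by apply/matrixP => i j; rewrite mxE; case: (ord2P i) => ->; case: (ord2P j) => ->.
move=> x; rewrite quad_formE symA.
have [z0|z0] := eqVneq (A 0 0) 0.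
  have -> : A 0 1 = 0 by apply/eqP; rewrite -sqrf_eq0 eq_le sqr_ge0 andbT; nra.
  by rewrite z0; have := mulr_ge0 a2 (sqr_ge0 (x 1 0)); lra.
have p0 : 0 < A 0 0 by rewrite lt_def z0.
rewrite -(pmulr_rge0 _ p0).
have := mulr_ge0 det_ge0 (sqr_ge0 (x 1 0)).
have := sqr_ge0 (A 0 0 * x 0 0 + A 0 1 * x 1 0); nra.
Qed.

Lemma psdv_adjv (R : realType) (B : 'M[R]_2) : psdv (adjv B) <-> psdv (symv B).
Proof.
by rewrite /psdv /detv !mxE /= sqrrN mulrC; split=> -[].
Qed.

Lemma symvK (R : realType) (u : 'rV[R]_3) : symv (symm u) = u.
Proof. by apply: row3P; rewrite !mxE. Qed.

Lemma adjvK (R : realType) (u : 'rV[R]_3) : adjv (adjm u) = u.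
Proof. by apply: row3P; rewrite !mxE //= opprK. Qed.

Lemma symm_psd (R : realType) (u : 'rV[R]_3) : psdv u -> psdmx (symm u).
Proof. by move=> pu; apply/psdmxP; rewrite symvK !mxE. Qed.

Lemma adjm_psd (R : realType) (u : 'rV[R]_3) : psdv u -> psdmx (adjm u).
Proof.
by move=> pu; apply/psdmxP; split; [rewrite !mxE|apply/psdv_adjv; rewrite adjvK].
Qed.

Lemma trace_pairv (R : realType) (A B : 'M[R]_2) :
  A 1 0 = A 0 1 -> B 1 0 = B 0 1 -> \tr (A *m B) = pairv (symv A) (adjv B).
Proof.
by move=> EA EB; rewrite /mxtrace sum2 !mxE !sum2 /pairv !mxE /= EA EB; ring.
Qed.

(** A vector with positive determinant is definite up to sign, so its pairing with
    a nonzero vector of the cone does not vanish. The proof is the reversed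
    Cauchy-Schwarz inequality in coordinates. *)
Lemma pairv_neq0 (R : realType) (u v : 'rV[R]_3) :
  0 < detv u -> psdv v -> v != 0 -> pairv u v != 0.
Proof.
rewrite /detv /pairv => du [v0 v2 dv]; apply: contraNneq => E.
have v02 : v 0 0 * v 0 2 = 0.
  apply/eqP; rewrite eq_le mulr_ge0 // andbT -(pmulr_rle0 _ du).
  have := sqr_ge0 (u 0 0 * v 0 2 - u 0 2 * v 0 0).
  have -> : (u 0 0 * v 0 2 - u 0 2 * v 0 0) ^+ 2 =
    (2 * u 0 1 * v 0 1) ^+ 2 - 4 * u 0 0 * u 0 2 * (v 0 0 * v 0 2).
    by rewrite -(addr0 (2 * u 0 1 * v 0 1)) -E; ring.
  have := mulr_ge0 (sqr_ge0 (u 0 1)) dv; rewrite /detv; nra.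
have v1 : v 0 1 = 0.
  by apply/eqP; rewrite -sqrf_eq0 eq_le sqr_ge0 andbT; move: dv; rewrite /detv; lra.
have u0 : u 0 0 != 0.
  by apply: contraTneq du => ->; have := sqr_ge0 (u 0 1); rewrite -leNgt; lra.
have u2 : u 0 2 != 0.
  by apply: contraTneq du => ->; have := sqr_ge0 (u 0 1); rewrite -leNgt; lra.
move/eqP: v02; rewrite mulf_eq0 => /orP[] /eqP z; move: E; rewrite z v1 => E.
  have z2 : v 0 2 = 0.
    by apply/eqP; move/eqP: E; rewrite !mulr0 !subr0 addr0 mulf_eq0 (negPf u0).
  by apply/eqP/row3P; rewrite mxE.
have z2 : v 0 0 = 0.
  by apply/eqP; move/eqP: E; rewrite !mulr0 !subr0 add0r mulf_eq0 (negPf u2).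
by apply/eqP/row3P; rewrite mxE.
Qed.

Lemma symv_eq0 (R : realType) (A : 'M[R]_2) : A 1 0 = A 0 1 -> (symv A == 0) = (A == 0).
Proof.
move=> symA; apply/eqP/eqP => [/rowP E|->]; last by apply: row3P; rewrite !mxE.
by apply: mx22P; [have := E 0|have := E 1|have := E 1|have := E 2]; rewrite !mxE //= ?symA.
Qed.

Lemma adjv_eq0 (R : realType) (A : 'M[R]_2) : A 1 0 = A 0 1 -> (adjv A == 0) = (A == 0).
Proof.
move=> symA; apply/eqP/eqP => [/rowP E|->]; last by apply: row3P; rewrite !mxE //= oppr0.
by apply: mx22P; [have := E 2|have := E 1|have := E 1|have := E 0];
  rewrite !mxE //= ?symA // => /eqP; rewrite oppr_eq0 => /eqP.
Qed.

Lemma symv_rank1 (R : realType) (x : 'cV[R]_2) :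
  symv (x *m x^T) = \row_k nth 0 [:: x 0 0 ^+ 2; x 0 0 * x 1 0; x 1 0 ^+ 2] k.
Proof. by apply: row3P; rewrite !mxE /= big_ord1 !mxE ?expr2. Qed.

Lemma adjv_rank1 (R : realType) (x : 'cV[R]_2) :
  adjv (x *m x^T) = symv (perp x *m (perp x)^T).
Proof. by apply: row3P; rewrite !mxE /= !big_ord1 !mxE /=; ring. Qed.

(** * Two factorizations of a rank-3 matrix differ by a linear map *)

Definition gram (R : realType) : 'M[R]_3 :=
  \matrix_(i, j) if (i + j == 2)%N then if i == 1 then - 2 else 1 else 0.

Lemma pairvE (R : realType) (u v : 'rV[R]_3) :
  pairv u v = (u *m gram R *m v^T) 0 0.
Proof. by rewrite !mxE sum3 !mxE !sum3 !mxE /= /pairv; ring. Qed.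

Lemma gram_unit (R : realType) : gram R \in unitmx.
Proof.
have E : gram R *m \matrix_(i, j)
    (if (i + j == 2)%N then if i == 1 then - 2^-1 else 1 else 0) = 1%:M.
  by apply/matrixP => i j; case: (ord3P i) => ->; case: (ord3P j) => ->;
    rewrite !mxE sum3 !mxE /=; field.
by have [] := mulmx1_unit E.
Qed.

Definition symrows (R : realType) p (A : 'I_p -> 'M[R]_2) : 'M[R]_(p, 3) :=
  \matrix_i symv (A i).
Definition adjrows (R : realType) p (A : 'I_p -> 'M[R]_2) : 'M[R]_(p, 3) :=
  \matrix_i adjv (A i).

Lemma psd_factorization_pairv (R : realType) p q (M : 'M[R]_(p, q)) A B i j :
  psd_factorization M A B -> M i j = pairv (symv (A i)) (adjv (B j)).
Proof.
move=> [psdA psdB ->]; apply: trace_pairv.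
  by case/psdmxP: (psdA i).
by case/psdmxP: (psdB j).
Qed.

Lemma pairv_row (R : realType) m q (P : 'M[R]_(m, 3)) (B : 'I_q -> 'M[R]_2) i j :
  pairv (row i P) (adjv (B j)) = (P *m (gram R *m (adjrows B)^T)) i j.
Proof.
rewrite pairvE mulmxA -row_mul !mxE; apply: eq_bigr => k _; congr (_ * _).
  by rewrite !mxE.
by rewrite !mxE.
Qed.

Lemma psd_factorization_mx (R : realType) p q (M : 'M[R]_(p, q)) A B :
  psd_factorization M A B -> M = symrows A *m (gram R *m (adjrows B)^T).
Proof.
move=> fact; apply/matrixP => i j; rewrite (psd_factorization_pairv i j fact).
by rewrite -pairv_row /symrows rowK.
Qed.

Section Rank3.
Variables (R : realType) (p q : nat) (M : 'M[R]_(p, q)).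
Hypothesis rankM : \rank M = 3%N.

Lemma factor_row_full (P : 'M[R]_(p, 3)) (Q : 'M[R]_(3, q)) : M = P *m Q -> row_full P.
Proof.
move=> E; rewrite /row_full eqn_leq rank_leq_col /=.
by rewrite -{1}rankM E mxrankM_maxl.
Qed.

Lemma factor_row_free (P : 'M[R]_(p, 3)) (Q : 'M[R]_(3, q)) : M = P *m Q -> row_free Q.
Proof.
move=> E; rewrite /row_free eqn_leq rank_leq_row /=.
by rewrite -{1}rankM E mxrankM_maxr.
Qed.

(** As M has rank 3, the factors A i span the three-dimensional space of symmetric
    matrices: a linear map is determined by its values on them. *)
Lemma symrows_span A B (m : nat) (X : 'M[R]_(3, m)) : psd_factorization M A B ->
  (forall i, symv (A i) *m X = 0) -> X = 0.
Proof.
move=> /psd_factorization_mx/factor_row_full/row_fullP[L LP] X0.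
rewrite -[X]mul1mx -LP -mulmxA; have -> : symrows A *m X = 0; last by rewrite mulmx0.
by apply/row_matrixP => i; rewrite row_mul /symrows rowK X0 row0.
Qed.

(** Both factorizations are rank-3 factorizations of the same matrix M, so they
    differ by a change of basis T of the space of symmetric matrices; the
    factors B j change by its inverse adjoint. *)
Lemma factorization_transfer A B A' B' :
  psd_factorization M A B -> psd_factorization M A' B' ->
  exists T : 'M[R]_3, [/\ T \in unitmx,
    forall i, symv (A' i) = symv (A i) *m T &
    forall r j, pairv (r *m T) (adjv (B' j)) = pairv r (adjv (B j))].
Proof.
move=> /psd_factorization_mx E /psd_factorization_mx E'.
have /row_fullP[L LP] := factor_row_full E.
have /row_freeP[N QN] := factor_row_free E'.
have [T ET] : exists T, symrows A *m T = symrows A'.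
  exists (gram R *m (adjrows B)^T *m N).
  by rewrite mulmxA -E {1}E' -mulmxA QN mulmx1.
exists T; split.
- have /row_fullP[L' LP'] := factor_row_full E'.
  by move: LP'; rewrite -ET mulmxA => /mulmx1_unit[].
- move=> i; rewrite -[LHS](rowK (fun i => symv (A' i))) -/(symrows A').
  by rewrite -ET row_mul /symrows rowK.
- move=> r j.
  have TQ : T *m (gram R *m (adjrows B')^T) = gram R *m (adjrows B)^T.
    rewrite -[LHS]mul1mx -[RHS]mul1mx -LP -!mulmxA; congr (L *m _).
    by rewrite mulmxA ET -E' E.
  have row0 (v : 'rV[R]_3) : row 0 v = v by apply/rowP => k; rewrite mxE.
  by rewrite -(row0 (r *m T)) -[in RHS](row0 r) !pairv_row -mulmxA TQ.
Qed.
End Rank3.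

(** * Linear maps that scale the determinant are congruences *)

Lemma pairvC (R : realType) (u v : 'rV[R]_3) : pairv u v = pairv v u.
Proof. by rewrite /pairv; ring. Qed.

Lemma pairvZl (R : realType) c (u v : 'rV[R]_3) : pairv (c *: u) v = c * pairv u v.
Proof. by rewrite /pairv !mxE; ring. Qed.

Lemma detvZ (R : realType) c (u : 'rV[R]_3) : detv (c *: u) = c ^+ 2 * detv u.
Proof. by rewrite /detv !mxE; ring. Qed.

Lemma symv_decomp (R : realType) (T : 'M[R]_3) (u : 'rV[R]_3) :
  u *m T = u 0 0 *: row 0 T + u 0 1 *: row 1 T + u 0 2 *: row 2 T.
Proof. by rewrite mulmx_sum_row sum3. Qed.

(** The determinant composed with T, restricted to the boundary rays x x^T of the
    cone, is a quartic in x. Its coefficients measure how far T is from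
    preserving the determinant up to a scalar. *)
Lemma conformal_quartic (R : realType) (T : 'M[R]_3) :
  exists h : 'rV[R]_5,
   [/\ forall x, bform h x = detv (symv (x *m x^T) *m T) &
    h = 0 -> [/\ detv (row 0 T) = 0, pairv (row 0 T) (row 1 T) = 0,
       detv (row 1 T) + pairv (row 0 T) (row 2 T) = 0,
       pairv (row 1 T) (row 2 T) = 0 & detv (row 2 T) = 0]].
Proof.
pose c := [:: detv (row 0 T); pairv (row 0 T) (row 1 T);
  detv (row 1 T) + pairv (row 0 T) (row 2 T); pairv (row 1 T) (row 2 T); detv (row 2 T)].
exists (\row_k nth 0 c k); split=> [x|/rowP h0].
  rewrite bformE !big_ord_recl big_ord0 /= !mxE /= symv_decomp symv_rank1 /bump /=.
  by rewrite /detv /pairv !mxE /=; ring.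
by split; [have := h0 0|have := h0 1|have := h0 2|have := h0 3|have := h0 4];
  rewrite !mxE.
Qed.

Lemma null_vector (R : realType) (u : 'rV[R]_3) : detv u = 0 ->
  exists (e : bool) (s : 'cV[R]_2), u = (-1) ^+ e *: symv (s *m s^T).
Proof.
rewrite /detv => /eqP; rewrite subr_eq0 => /eqP du.
have pos (v : 'rV[R]_3) : v 0 0 * v 0 2 = v 0 1 ^+ 2 -> 0 <= v 0 0 -> 0 <= v 0 2 ->
  exists s : 'cV[R]_2, v = symv (s *m s^T).
  move=> dv v0 v2; have [z|z] := eqVneq (v 0 0) 0.
    have v1 : v 0 1 = 0 by apply/eqP; rewrite -sqrf_eq0 -dv z mul0r.
    exists (\col_i nth 0 [:: 0; Num.sqrt (v 0 2)] i); rewrite symv_rank1.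
    by apply: row3P; rewrite !mxE /= ?sqr_sqrtr // ?z ?v1; ring.
  have s0 : Num.sqrt (v 0 0) != 0 by rewrite sqrtr_eq0 -ltNge lt_def z.
  have s2 := sqr_sqrtr v0.
  exists (\col_i nth 0 [:: Num.sqrt (v 0 0); v 0 1 / Num.sqrt (v 0 0)] i).
  rewrite symv_rank1; apply: row3P; rewrite !mxE /= ?s2 //.
    by field.
  by rewrite expr_div_n s2 -dv; field.
have sgn : 0 <= u 0 0 /\ 0 <= u 0 2 \/ u 0 0 <= 0 /\ u 0 2 <= 0.
  have := sqr_ge0 (u 0 1); rewrite -du => m.
  have [u0|u0|u0] := ltgtP (u 0 0) 0.
  - by right; split; [by []|rewrite -(nmulr_rge0 _ u0)].
  - by left; split; [by []|rewrite -(pmulr_rge0 _ u0)].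
  - by have [/ltW ?|?] := ltP 0 (u 0 2); [left|right].
case: sgn => -[u0 u2].
  by have [s ->] := pos u du u0 u2; exists false, s; rewrite scale1r.
have [|||s Es] := pos (- u); rewrite ?mxE ?oppr_ge0 //.
  by rewrite mulrNN sqrrN.
by exists true, s; rewrite -Es scaleN1r opprK.
Qed.

Definition rows2 (R : realType) (s u : 'cV[R]_2) : 'M[R]_2 :=
  \matrix_(i, j) if i == 0 then s j 0 else u j 0.

Lemma rows2_unit (R : realType) (s u : 'cV[R]_2) : det2 s u != 0 -> rows2 s u \in unitmx.
Proof.
move=> d0.
rewrite det2E in d0.
pose N : 'M[R]_2 := \matrix_(i, j) (nth 0 (nth [::] [:: [:: u 1 0; - s 1 0];
  [:: - u 0 0; s 0 0]] i) j / (s 0 0 * u 1 0 - s 1 0 * u 0 0)).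
suff /mulmx1_unit[] : rows2 s u *m N = 1%:M by [].
by apply: mx22P; rewrite !mxE sum2 !mxE /=; field.
Qed.

(** A linear map that scales the determinant is a congruence up to sign. It maps
    E_11 and E_22 to rank-one matrices, up to sign s s^T and u u^T. The image of
    E_12 + E_21 is orthogonal to both, hence a multiple b of s u^T + u s^T;
    comparing determinants gives b ^ 2 = 1 and equal signs for the first two
    images, so that S has rows s and, up to sign, u. *)
Lemma conformal_congruence (R : realType) (T : 'M[R]_3) :
  T \in unitmx ->
  detv (row 0 T) = 0 -> pairv (row 0 T) (row 1 T) = 0 ->
  detv (row 1 T) + pairv (row 0 T) (row 2 T) = 0 ->
  pairv (row 1 T) (row 2 T) = 0 -> detv (row 2 T) = 0 ->
  exists (e : bool) (S : 'M[R]_2), S \in unitmx /\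
    forall A : 'M[R]_2, A 1 0 = A 0 1 ->
      symv A *m T = (-1) ^+ e *: symv (S^T *m A *m S).
Proof.
move=> uT q0 l01 q1 l12 q2.
have [e [s E0]] := null_vector q0.
have [f [u E2]] := null_vector q2.
pose d := det2 s u.
have l02 : pairv (row 0 T) (row 2 T) = (-1) ^+ e * (-1) ^+ f * d ^+ 2.
  by rewrite E0 E2 !symv_rank1 /pairv !mxE /= /d det2E; ring.
have d0 : d != 0.
  (* If s and u were proportional, all pairings of rows of T would vanish, whereas
     their Gram matrix T gram T^T is invertible. *)
  apply: contraTneq uT => d0; move: q1; rewrite l02 d0 expr0n mulr0 addr0 => q1.
  apply: contraTN isT => uT.
  have : T *m gram R *m T^T \in unitmx by rewrite !unitmx_mul uT gram_unit unitmx_tr.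
  have -> : T *m gram R *m T^T = 0; last by rewrite unitmxE det0 unitr0.
  have pair0 i : pairv (row i T) (row i T) = 2 * detv (row i T).
    by rewrite /pairv /detv; ring.
  move: l02; rewrite d0 expr0n mulr0 => l02.
  apply/matrixP => i j; rewrite [RHS]mxE.
  have -> : (T *m gram R *m T^T) i j = pairv (row i T) (row j T).
    rewrite pairvE -row_mul mxE [RHS]mxE; apply: eq_bigr => k _.
    by rewrite !mxE.
  by case: (ord3P i) => ->; case: (ord3P j) => ->;
    rewrite ?pair0 ?q0 ?q1 ?q2 ?l01 ?l02 ?l12 ?mulr0 // pairvC.
pose sg : 'rV[R]_3 := \row_k nth 0 [:: 2 * s 0 0 * u 0 0;
  s 0 0 * u 1 0 + s 1 0 * u 0 0; 2 * s 1 0 * u 1 0] k.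
(* Expansion of r in the basis s s^T, u u^T, s u^T + u s^T, whose Gram matrix
   for pairv has only the nonzero entries d^2, d^2 and - 2 d^2. *)
have frame r : d ^+ 2 *: r = pairv r (symv (u *m u^T)) *: symv (s *m s^T)
   + pairv r (symv (s *m s^T)) *: symv (u *m u^T) - (pairv r sg / 2) *: sg.
  by apply: row3P; rewrite !symv_rank1 /pairv !mxE /= /d det2E; field.
have sgn0 (b : bool) : (-1) ^+ b != 0 :> R by rewrite signr_eq0.
have ls : pairv (row 1 T) (symv (s *m s^T)) = 0.
  by apply: (mulfI (sgn0 e)); rewrite mulr0 -l01 E0 pairvZl pairvC.
have lu : pairv (row 1 T) (symv (u *m u^T)) = 0.
  by apply: (mulfI (sgn0 f)); rewrite mulr0 -l12 E2 pairvC -pairvZl pairvC.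
pose b := - (pairv (row 1 T) sg / 2) / d ^+ 2.
have E1 : row 1 T = b *: sg.
  have := frame (row 1 T); rewrite ls lu !scale0r add0r sub0r => E.
  rewrite -[LHS](scalerK (a := d ^+ 2)) ?expf_neq0 //.
  by rewrite E -scaleNr scalerA mulrC.
have qsg : detv sg = - d ^+ 2 by rewrite /detv !mxE /= /d det2E; ring.
have bb : b ^+ 2 = (-1) ^+ e * (-1) ^+ f.
  have : detv (row 1 T) = - b ^+ 2 * d ^+ 2.
    by rewrite E1 detvZ qsg; ring.
  move=> q1E; move: q1; rewrite q1E l02 => /eqP.
  rewrite -mulrDl mulf_eq0 expf_eq0 (negPf d0) orbF addrC subr_eq0 => /eqP ->; ring.
have fe : f = e.
  have := sqr_ge0 b; rewrite bb; case: (e) (f) => -[] //=; rewrite ?expr0 ?expr1; lra.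
have bne : b != 0.
  by rewrite -sqrf_eq0 bb; rewrite mulf_neq0.
have b2 : b ^+ 2 = 1 by rewrite bb fe -expr2 sqrr_sign.
exists e, (rows2 s ((-1) ^+ e * b *: u)); split.
  apply: rows2_unit; have -> : det2 s ((-1) ^+ e * b *: u) = (-1) ^+ e * b * d.
    by rewrite /d !det2E !mxE; ring.
  by rewrite (mulf_neq0 (mulf_neq0 (sgn0 e) bne) d0).
move=> A symA; rewrite symv_decomp E0 E1 E2 fe !symv_rank1.
have ee : (-1) ^+ e * (-1) ^+ e = 1 :> R by rewrite -expr2 sqrr_sign.
apply: row3P; rewrite !mxE !sum2 !mxE !sum2 !mxE /= symA.
all: move: b2 ee; generalize ((-1) ^+ e : R) b => eps c; rewrite expr2 => c2 e2.
all: by ring: c2 e2.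
Qed.

(** * Alternation forces uniqueness *)

Lemma psdmx_congr (R : realType) (A S : 'M[R]_2) : psdmx A -> psdmx (S^T *m A *m S).
Proof.
move=> [symA posA]; split; first by rewrite !trmx_mul trmxK symA mulmxA.
by move=> x; have := posA (S *m x); rewrite trmx_mul !mulmxA.
Qed.

Lemma symv_inj (R : realType) (A B : 'M[R]_2) :
  A 1 0 = A 0 1 -> B 1 0 = B 0 1 -> symv A = symv B -> A = B.
Proof.
move=> symA symB /rowP E.
by apply: mx22P; rewrite ?symA ?symB;
  [have := E 0|have := E 1|have := E 1|have := E 2]; rewrite !mxE.
Qed.

Lemma pairv_inj (R : realType) (u v : 'rV[R]_3) :
  (forall r, pairv r u = pairv r v) -> u = v.
Proof.
move=> E.
pose d k : 'rV[R]_3 := \row_l (l == k)%:R.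
by have := E (d 0); have := E (d 1); have := E (d 2); rewrite /pairv !mxE /= => E0 E1 E2;
  apply: row3P; lra.
Qed.

Lemma adjv_inj (R : realType) (A B : 'M[R]_2) :
  A 1 0 = A 0 1 -> B 1 0 = B 0 1 -> adjv A = adjv B -> A = B.
Proof.
move=> symA symB /rowP E.
by apply: mx22P; rewrite ?symA ?symB; [have := E 2|have := E 1|have := E 1|have := E 0];
   rewrite !mxE //= => /oppr_inj.
Qed.

(** Let T carry the given factorization to another one, and let h be the quartic
    det (T (x x^T)). At the vectors a k it is the determinant of a psd factor,
    so it is nonnegative. At perp (b l) the matrix T (x x^T) is orthogonal to
    the nonzero psd factor B' (j l), so its determinant is nonpositive. By
    rigidity h = 0, so T is a congruence up to sign, and positivity of the
    factors excludes the negative sign. *)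
Lemma rigid_unique (R : realType) p q (M : 'M[R]_(p, q)) A B
    (a b : 'I_3 -> 'cV[R]_2) (i : 'I_3 -> 'I_p) (j : 'I_3 -> 'I_q) :
  \rank M = 3%N -> psd_factorization M A B ->
  (forall k, A (i k) = a k *m (a k)^T) ->
  (forall l, B (j l) = b l *m (b l)^T) ->
  (forall l, B (j l) != 0) ->
  (forall h : 'rV[R]_5, (forall k, 0 <= bform h (a k)) ->
     (forall l, bform h (perp (b l)) <= 0) -> h = 0) ->
  unique_psd_factorization M A B.
Proof.
move=> rankM fact Aa Bb Bj0 rig; split=> // A' B' fact'.
have [T [uT TA TB]] := factorization_transfer rankM fact fact'.
have [psdA psdB _] := fact; have [psdA' psdB' _] := fact'.
have symP (X : 'M[R]_2) : psdmx X -> X 1 0 = X 0 1 by move=> /psdmxP[].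
have [h [Eh]] := conformal_quartic T.
case=> [|q0 l01 q1 l12 q2].
  apply: rig => [k|l]; rewrite Eh.
    by rewrite -Aa -TA; have /psdmxP[_ []] := psdA' (i k).
  rewrite leNgt; apply/negP => du; have := @pairv_neq0 _ _ (adjv (B' (j l))) du.
  rewrite TB Bb adjv_rank1 => nz.
  have : pairv (symv (perp (b l) *m (perp (b l))^T))
      (symv (perp (b l) *m (perp (b l))^T)) != 0.
    apply: nz; first by apply/psdv_adjv; case/psdmxP: (psdB' (j l)).
    apply: contraNneq (Bj0 l) => B'0; rewrite -adjv_eq0; last exact/symP.
    apply/eqP/pairv_inj => r; rewrite -TB B'0 /pairv !mxE; ring.
  by rewrite symv_rank1 /pairv !mxE /= => /eqP; apply; ring.
have [e [S [uS ES]]] := conformal_congruence uT q0 l01 q1 l12 q2.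
have e0 : e = false.
  apply/negbTE/negP => e1; rewrite {}e1 in ES.
  suff T0 : T = 0 by move: uT; rewrite T0 unitmxE det0 unitr0.
  apply: (symrows_span rankM fact) => k.
  have /psdmxP[_ [p0 p2 pd]] := psdA' k.
  have /psdmxP[_ [s0 s2 sd]] := psdmx_congr S (psdA k).
  move: p0 p2 pd; rewrite TA (ES _ (symP _ (psdA k))) scaleN1r.
  move: (symv _) s0 s2 sd => w s0 s2 sd; rewrite !mxE /detv !mxE => p0 p2 pd.
  have w0 : w 0 0 = 0 by lra.
  have w2 : w 0 2 = 0 by lra.
  have w1 : w 0 1 = 0.
    by apply/eqP; rewrite -sqrf_eq0 eq_le sqr_ge0 andbT; move: sd; rewrite /detv w0; lra.
  by apply: row3P; rewrite !mxE ?w0 ?w1 ?w2 oppr0.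
exists S; split=> // [k|l].
  apply: symv_inj; [exact/symP|exact/symP/psdmx_congr|].
  by rewrite TA ES ?e0 ?scale1r //; apply/symP.
have EB : B l = S *m B' l *m S^T.
  have psdSB : psdmx (S *m B' l *m S^T) by rewrite -{1}[S]trmxK; apply: psdmx_congr.
  apply: adjv_inj; [exact/symP|exact/symP|].
  apply: pairv_inj => r; rewrite -TB.
  have symr : symm r 1 0 = symm r 0 1 by rewrite !mxE.
  rewrite -(symvK r) (ES _ symr) e0 scale1r.
  have symSr : (S^T *m symm r *m S) 1 0 = (S^T *m symm r *m S) 0 1.
    by rewrite !mxE !sum2 !mxE !sum2 !mxE /=; ring.
  rewrite -!trace_pairv ?(symP _ (psdB' l)) ?(symP _ psdSB) //.
  by rewrite -!mulmxA mxtrace_mulC !mulmxA.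
by rewrite EB trmx_inv !mulmxA mulVmx // mul1mx -mulmxA mulmxV ?mulmx1 ?unitmx_tr.
Qed.

(** * Deforming a factorization along a quartic *)

Definition near0 (R : realType) (P : R -> Prop) : Prop :=
  exists2 d : R, 0 < d & forall t, 0 < t -> t < d -> P t.

Lemma near0W (R : realType) (P : R -> Prop) : near0 P -> exists2 t, 0 < t & P t.
Proof.
by move=> [d d0 Pd]; exists (d / 2); [|apply: Pd]; lra.
Qed.

Lemma near0_imp (R : realType) (P Q : R -> Prop) :
  (forall t, 0 < t -> P t -> Q t) -> near0 P -> near0 Q.
Proof. by move=> PQ [d d0 Pd]; exists d => // t t0 td; apply/PQ/Pd. Qed.

Lemma near0_and (R : realType) (P Q : R -> Prop) :
  near0 P -> near0 Q -> near0 (fun t => P t /\ Q t).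
Proof.
move=> [d d0 Pd] [e e0 Qe]; exists (Num.min d e); first by rewrite lt_min d0.
by move=> t t0; rewrite lt_min => /andP[td te]; split; [apply: Pd|apply: Qe].
Qed.

Lemma near0_all (R : realType) (I : finType) (P : I -> R -> Prop) :
  (forall i, near0 (P i)) -> near0 (fun t => forall i, P i t).
Proof.
move=> Pi; suff : near0 (fun t => forall i, i \in enum I -> P i t).
  by apply: near0_imp => t _ H i; apply: H; rewrite mem_enum.
elim: (enum I) => [|i s IHs]; first by exists 1.
apply: near0_imp (near0_and (Pi i) IHs) => t _ [Pit Pst] k.
by rewrite inE => /orP[/eqP ->|/Pst].
Qed.

Lemma near0_pos (R : realType) (c0 c1 c2 c3 c4 : R) :
  0 < c0 \/ c0 = 0 /\ 0 < c1 ->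
  near0 (fun t => 0 < c0 + c1 * t + c2 * t ^+ 2 + c3 * t ^+ 3 + c4 * t ^+ 4).
Proof.
have pos (a0 a1 a2 a3 a4 : R) : 0 < a0 ->
    near0 (fun t => 0 < a0 + a1 * t + a2 * t ^+ 2 + a3 * t ^+ 3 + a4 * t ^+ 4).
  move=> a0_gt0; pose K := `|a1| + `|a2| + `|a3| + `|a4| + 1.
  have K0 : 0 < K by rewrite /K ltr_wpDl // !addr_ge0.
  exists (Num.min 1 (a0 / K)); first by rewrite lt_min ltr01 divr_gt0.
  move=> t t0; rewrite lt_min ltr_pdivlMr // => /andP[t1 tK].
  have term a n : - (`|a| * t) <= a * t ^+ n.+1.
    rewrite lerNl -mulNr; apply: (@le_trans _ _ (`|a| * t ^+ n.+1)).
      by rewrite ler_wpM2r ?exprn_ge0 ?(ltW t0) // lerNl lerNnormlW.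
    rewrite ler_wpM2l // exprS ler_piMr ?(ltW t0) //.
    by rewrite exprn_ile1 // ltW.
  have := term a1 0%N; have := term a2 1%N; have := term a3 2%N; have := term a4 3%N.
  by rewrite expr1; move: tK; rewrite /K; lra.
move=> [c0_gt0|[-> c1_gt0]]; first exact: pos.
apply: near0_imp (pos c1 c2 c3 c4 0 c1_gt0) => t t0 H.
have := mulr_gt0 t0 H; congr (0 < _); ring.
Qed.

(** A matrix D that is self-adjoint for pairv and satisfies pairv u (u D) = H(u),
    where H is a quadratic form on symmetric matrices whose restriction to the
    rays x x^T is the quartic h. Along 1 + t D the determinant of x x^T grows
    like t h(x), and self-adjointness makes the factors B, in adjugate
    coordinates, move by the inverse of the same matrix. *)
Definition generator (R : realType) (h : 'rV[R]_5) : 'M[R]_3 :=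
  \matrix_(i, j) nth 0 (nth [::]
    [:: [:: 0; - (h 0 1 / 4); h 0 0];
        [:: h 0 3 / 2; - (h 0 2 / 2); h 0 1 / 2];
        [:: h 0 4; - (h 0 3 / 4); 0]] i) j.

Lemma mulmx3E (R : realType) (u : 'rV[R]_3) (T : 'M[R]_3) k :
  (u *m T) 0 k = u 0 0 * T 0 k + u 0 1 * T 1 k + u 0 2 * T 2 k.
Proof. by rewrite mxE sum3. Qed.

Lemma generator_selfadjoint (R : realType) (h : 'rV[R]_5) (u v : 'rV[R]_3) :
  pairv (u *m generator h) v = pairv u (v *m generator h).
Proof. by rewrite /pairv !mulmx3E !mxE /=; field. Qed.

Lemma generator_first_order (R : realType) (h : 'rV[R]_5) (x : 'cV[R]_2) :
  pairv (symv (x *m x^T)) (symv (x *m x^T) *m generator h) = bform h x.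
Proof.
rewrite bformE !big_ord_recl big_ord0 symv_rank1 /pairv !mulmx3E !mxE /= /bump /=.
have -> : lift ord0 ord0 = 1 :> 'I_5 by apply: val_inj.
have -> : lift ord0 (lift ord0 ord0) = 2 :> 'I_5 by apply: val_inj.
have -> : lift ord0 (lift ord0 (lift ord0 ord0)) = 3 :> 'I_5 by apply: val_inj.
have -> : lift ord0 (lift ord0 (lift ord0 (lift ord0 ord0))) = 4 :> 'I_5 by apply: val_inj.
by field.
Qed.

(** A quartic that vanishes doubly at y leaves the ray y y^T fixed: the factors on
    this ray stay in the cone, although the determinant does not grow there. *)
Lemma generator_tangent (R : realType) (y : 'cV[R]_2) (g : 'rV[R]_3) :
  exists h : 'rV[R]_5, (forall x, bform h x = det2 x y ^+ 2 * bform g x) /\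
    exists k, symv (y *m y^T) *m generator h = k *: symv (y *m y^T).
Proof.
pose u := y 0 0; pose v := y 1 0.
exists (\row_i nth 0 [:: v ^+ 2 * g 0 0; v ^+ 2 * g 0 1 - 2 * u * v * g 0 0;
  v ^+ 2 * g 0 2 - 2 * u * v * g 0 1 + u ^+ 2 * g 0 0;
  u ^+ 2 * g 0 1 - 2 * u * v * g 0 2; u ^+ 2 * g 0 2] i); split.
  move=> x; rewrite !bformE !big_ord_recl !big_ord0 !mxE /= det2E /bump /= -/u -/v.
  have -> : lift ord0 ord0 = 1 :> 'I_3 by apply: val_inj.
  have -> : lift ord0 (lift ord0 ord0) = 2 :> 'I_3 by apply: val_inj.
  by ring.
exists (u * v * g 0 1 / 2).
by apply: row3P; rewrite mulmx3E symv_rank1 !mxE /= -/u -/v; field.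
Qed.

Lemma cayley_hamilton3 (R : realType) (D : 'M[R]_3) :
  exists e1 e2 e3 : R, D *m (D *m D - e1 *: D + e2%:M) = e3%:M.
Proof.
exists (D 0 0 + D 1 1 + D 2 2).
exists (D 0 0 * D 1 1 - D 0 1 * D 1 0 + D 0 0 * D 2 2 - D 0 2 * D 2 0
  + D 1 1 * D 2 2 - D 1 2 * D 2 1).
exists (D 0 0 * D 1 1 * D 2 2 + D 0 1 * D 1 2 * D 2 0 + D 0 2 * D 1 0 * D 2 1
  - D 0 2 * D 1 1 * D 2 0 - D 0 1 * D 1 0 * D 2 2 - D 0 0 * D 1 2 * D 2 1).
by apply/matrixP => i j; case: (ord3P i) => ->; case: (ord3P j) => ->;
  rewrite !mxE sum3 !mxE !sum3 /=; ring.
Qed.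

(** The adjugate of 1 + t D is quadratic in t, by the Cayley-Hamilton theorem. Having
    it as a polynomial reduces positivity of the deformed factors to the signs
    of constant and linear coefficients. *)
Lemma pencil_inverse (R : realType) (D : 'M[R]_3) :
  exists (e1 e2 e3 : R) (N2 : 'M[R]_3), forall t,
    (1%:M + t *: D) *m (1%:M + t *: (e1%:M - D) + t ^+ 2 *: N2) =
    (1 + e1 * t + e2 * t ^+ 2 + e3 * t ^+ 3)%:M.
Proof.
have [e1 [e2 [e3 CH]]] := cayley_hamilton3 D.
exists e1, e2, e3, (D *m D - e1 *: D + e2%:M) => t.
rewrite mulmxDl mul1mx -scalemxAl !mulmxDr mulmx1 -!scalemxAr CH mulmxBr mul_mx_scalar.
move: (D *m D) => D2; apply/matrixP => i j; rewrite !mxE.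
by case: (i == j); rewrite ?mulr1n ?mulr0n; ring.
Qed.

Lemma psdv_trace (R : realType) (v : 'rV[R]_3) :
  0 <= detv v -> 0 < v 0 0 + v 0 2 -> psdv v.
Proof.
rewrite /psdv /detv => dv tv; have := sqr_ge0 (v 0 1) => v1.
by split=> //; rewrite leNgt; apply/negP => lt0; nra.
Qed.

Lemma psdv_trace_gt0 (R : realType) (v : 'rV[R]_3) :
  psdv v -> v != 0 -> 0 < v 0 0 + v 0 2.
Proof.
move=> [v0 v2]; rewrite /detv => dv; apply: contra_neqT; rewrite -leNgt => le0.
have z0 : v 0 0 = 0 by lra.
have z2 : v 0 2 = 0 by lra.
have z1 : v 0 1 = 0.
  by apply/eqP; rewrite -sqrf_eq0 eq_le sqr_ge0 andbT; move: dv; rewrite z0; lra.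
by apply: row3P; rewrite mxE.
Qed.

Lemma psdvZ (R : realType) c (v : 'rV[R]_3) : 0 <= c -> psdv v -> psdv (c *: v).
Proof. by move=> c0 [v0 v2 dv]; split; rewrite ?detvZ ?mxE mulr_ge0 ?sqr_ge0. Qed.

(** Moving from a ray of the cone along a curve, the determinant stays nonnegative
    if it is positive or if its first-order variation is; the trace stays
    positive, which keeps the curve in the right half of the cone. *)
Lemma near0_psdv (R : realType) (u y z : 'rV[R]_3) :
  psdv u -> u != 0 -> 0 < detv u \/ detv u = 0 /\ 0 < pairv u y ->
  near0 (fun t => psdv (u + t *: y + t ^+ 2 *: z)).
Proof.
move=> pu u0 first_order.
have tr_near0 := near0_pos (c1 := y 0 0 + y 0 2) (z 0 0 + z 0 2) 0 0
   (or_introl (psdv_trace_gt0 pu u0)).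
have det_near0 := near0_pos (detv y + pairv u z) (pairv y z) (detv z) first_order.
have := near0_and det_near0 tr_near0.
apply: near0_imp => t _ [qt tt]; apply: psdv_trace.
  by rewrite ltW //; move: qt; congr (0 < _); rewrite /detv /pairv !mxE; ring.
by move: tt; congr (0 < _); rewrite !mxE; ring.
Qed.

Lemma psd_rank1 (R : realType) (A : 'M[R]_2) :
  psdmx A -> A != 0 -> detv (symv A) = 0 -> \rank A = 1%N.
Proof.
move=> /psdmxP[symA pA] A0 /null_vector[e [s Es]].
have EA : A = ((-1) ^+ e *: s) *m s^T.
  apply: symv_inj => //; first by rewrite -scalemxAl !mxE !big_ord1 !mxE; ring.
  by rewrite Es -scalemxAl; apply: row3P; rewrite !mxE.
apply/eqP; rewrite eqn_leq lt0n mxrank_eq0 A0 andbT EA.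
exact: leq_trans (mxrankM_maxl _ _) (rank_leq_col _).
Qed.

Lemma detv_rank1 (R : realType) (x : 'cV[R]_2) : detv (symv (x *m x^T)) = 0.
Proof. by rewrite symv_rank1 /detv !mxE /=; ring. Qed.

Lemma congruence_matrix (R : realType) (S : 'M[R]_2) :
  exists C : 'M[R]_3, forall A : 'M[R]_2, A 1 0 = A 0 1 ->
    symv (S^T *m A *m S) = symv A *m C.
Proof.
pose d k : 'rV[R]_3 := \row_l (l == k)%:R.
exists (\matrix_k symv (S^T *m symm (d k) *m S)) => A symA.
by apply: row3P; rewrite mulmx3E !mxE !sum2 !mxE !sum2 !mxE /= symA; ring.
Qed.

(** Deform the A i by 1 + t D and the B j, in adjugate coordinates, by its inverse.
    Factors of rank two stay definite for small t. On a factor of rank one the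
    first-order change of the determinant is h (for the A i) or - h (for the
    B j), positive by hypothesis, unless the ray is fixed. The deformed
    factorization is not in the orbit of the original one: a congruence
    preserves singularity, whereas the determinant of the image of x x^T is
    t h(x) to first order. *)
Lemma deformation_not_unique (R : realType) p q (M : 'M[R]_(p, q)) A B
    (a : 'I_p -> 'cV[R]_2) (b : 'I_q -> 'cV[R]_2) (h : 'rV[R]_5) :
  \rank M = 3%N -> psd_factorization M A B ->
  (forall i, A i != 0) -> (forall j, B j != 0) ->
  (forall i, \rank (A i) = 1%N -> A i = a i *m (a i)^T) ->
  (forall j, \rank (B j) = 1%N -> B j = b j *m (b j)^T) ->
  (forall i, \rank (A i) = 1%N -> 0 < bform h (a i) \/
     exists k, symv (a i *m (a i)^T) *m generator h = k *: symv (a i *m (a i)^T)) ->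
  (forall j, \rank (B j) = 1%N -> bform h (perp (b j)) < 0 \/
     exists k, symv (perp (b j) *m (perp (b j))^T) *m generator h =
        k *: symv (perp (b j) *m (perp (b j))^T)) ->
  (exists x, bform h x != 0) ->
  ~ unique_psd_factorization M A B.
Proof.
move=> rankM fact A0 B0 Aa Bb ha hb [x hx] [_ uniq].
have [psdA psdB _] := fact.
set D := generator h in ha hb.
have [e1 [e2 [e3 [N2 EN]]]] := pencil_inverse D.
pose T t : 'M[R]_3 := 1%:M + t *: D.
(* N t is the adjugate of T t and e t its determinant. *)
pose N t : 'M[R]_3 := 1%:M + t *: (e1%:M - D) + t ^+ 2 *: N2.
pose e t := 1 + e1 * t + e2 * t ^+ 2 + e3 * t ^+ 3.
have uT u t : u *m T t = u + t *: (u *m D).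
  by rewrite mulmxDr mulmx1 -scalemxAr.
have near0_e : near0 (fun t => 0 < e t).
  apply: near0_imp (near0_pos (c1 := e1) e2 e3 0 (or_introl ltr01)) => t _.
  by congr (0 < _); rewrite /e; ring.
have near0_k (k : R) : near0 (fun t => 0 < 1 + t * k).
  apply: near0_imp (near0_pos (c1 := k) 0 0 0 (or_introl ltr01)) => t _.
  by congr (0 < _); ring.
have NT t : 0 < e t -> N t *m T t = (e t)%:M.
  move=> et; have : T t *m ((e t)^-1 *: N t) = 1%:M.
    by rewrite -scalemxAr EN scale_scalar_mx mulVf // gt_eqF.
  move/mulmx1C; rewrite -scalemxAl => E.
  by rewrite -[LHS](scalerKV (a := e t)) ?gt_eqF // E scale_scalar_mx mulr1.
have near0A i : near0 (fun t => psdv (symv (A i) *m T t)).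
  have [symA pA] := (psdmxP _).1 (psdA i).
  have nA : symv (A i) != 0 by rewrite symv_eq0.
  have [q0|q0] := eqVneq (detv (symv (A i))) 0; last first.
    apply: near0_imp (near0_psdv (y := symv (A i) *m D) 0 pA nA _).
      by move=> t _; rewrite uT scaler0 addr0.
    by left; rewrite lt_def q0; case: pA.
  have rk := psd_rank1 (psdA i) (A0 i) q0.
  rewrite (Aa _ rk) in pA nA q0 *.
  case: (ha i rk) => [hi|[k Ek]].
    apply: near0_imp (near0_psdv (y := symv (a i *m (a i)^T) *m D) 0 pA nA _).
      by move=> t _; rewrite uT scaler0 addr0.
    by right; rewrite generator_first_order.
  apply: near0_imp (near0_k k) => t _ tk.
  rewrite uT Ek scalerA -{1}[symv _]scale1r -scalerDl.
  exact: psdvZ (ltW tk) pA.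
have near0B j : near0 (fun t => psdv (adjv (B j) *m N t)).
  have [symB /psdv_adjv pB] := (psdmxP _).1 (psdB j).
  have nB : adjv (B j) != 0 by rewrite adjv_eq0.
  have uN u t : u *m N t = u + t *: (e1 *: u - u *m D) + t ^+ 2 *: (u *m N2).
    by rewrite !mulmxDr mulmx1 -!scalemxAr mulmxBr mul_mx_scalar.
  have [q0|q0] := eqVneq (detv (adjv (B j))) 0; last first.
    apply: near0_imp (near0_psdv (y := e1 *: adjv (B j) - adjv (B j) *m D)
       (adjv (B j) *m N2) pB nB _) => [t _|]; first by rewrite uN.
    by left; rewrite lt_def q0; case: pB.
  have rk : \rank (B j) = 1%N.
    by apply: psd_rank1 => //; move: q0; rewrite /detv !mxE /= sqrrN mulrC.
  rewrite (Bb _ rk) adjv_rank1 in pB nB q0 *.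
  case: (hb j rk) => [hj|[k Ek]].
    set v := symv _ in pB nB q0 *.
    apply: near0_imp (near0_psdv (y := e1 *: v - v *m D) (v *m N2) pB nB _) => [t _|].
      by rewrite uN.
    right; split=> //.
    have -> : pairv v (e1 *: v - v *m D) = 2 * e1 * detv v - pairv v (v *m D).
      by rewrite /pairv /detv; move: (v *m D) => w; rewrite !mxE; ring.
    by rewrite q0 generator_first_order mulr0 sub0r oppr_gt0.
  apply: near0_imp (near0_and (near0_k k) near0_e) => t _ [tk et].
  set v := symv _ in pB nB q0 Ek *.
  have vT : v *m T t = (1 + t * k) *: v by rewrite uT Ek scalerA scalerDl scale1r.
  have -> : v *m N t = ((1 + t * k)^-1 * e t) *: v.
    have : (1 + t * k) *: (v *m N t) = e t *: v.
      by rewrite scalemxAl -vT -mulmxA EN mul_mx_scalar.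
    move/(congr1 (fun w => (1 + t * k)^-1 *: w)).
    by rewrite scalerK ?gt_eqF // scalerA.
  by apply: psdvZ => //; rewrite mulr_ge0 ?invr_ge0 ?ltW.
have near0_x : near0 (fun t => detv (symv (x *m x^T) *m T t) != 0).
  pose u := symv (x *m x^T).
  have E t : detv (u *m T t) = t * bform h x + t ^+ 2 * detv (u *m D).
    rewrite uT -generator_first_order -/D /u.
    move: (detv_rank1 x); move: (symv _) => v; move: (v *m D) => w.
    rewrite /detv => q0; transitivity (detv v + t * pairv v w + t ^+ 2 * detv w).
      by rewrite /detv /pairv !mxE; ring.
    by rewrite {1}/detv q0 add0r.
  have [h0|h0|h0] := ltgtP 0 (bform h x); last by rewrite h0 eqxx in hx.
    apply: near0_imp (near0_pos (detv (u *m D)) 0 0 (or_intror (conj erefl h0))) => t _.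
    by move=> pos; rewrite gt_eqF //; move: pos; congr (0 < _); rewrite E; ring.
  rewrite -oppr_gt0 in h0.
  apply: near0_imp (near0_pos (- detv (u *m D)) 0 0 (or_intror (conj erefl h0))) => t _.
  move=> pos; rewrite lt_eqF // -oppr_gt0; move: pos; congr (0 < _); rewrite E; ring.
have [t t0 [et [At [Bt xt]]]] := near0W (near0_and near0_e
  (near0_and (near0_all near0A) (near0_and (near0_all near0B) near0_x))).
pose A' i := symm (symv (A i) *m T t).
pose B' j := adjm ((e t)^-1 *: (adjv (B j) *m N t)).
have selfadj u v : pairv (u *m T t) v = pairv u (v *m T t).
  rewrite !uT; have := generator_selfadjoint h u v; rewrite -/D.
  move: (u *m D) (v *m D) => y z E.
  transitivity (pairv u v + t * pairv y v); last rewrite E.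
    by rewrite /pairv !mxE; ring.
  by rewrite /pairv !mxE; ring.
have fact' : psd_factorization M A' B'.
  split=> [i|j|i j].
  - exact: symm_psd.
  - by apply/adjm_psd/psdvZ => //; rewrite invr_ge0 ltW.
  rewrite (psd_factorization_pairv i j fact) trace_pairv ?symvK ?adjvK; last 2 first.
  - by rewrite !mxE.
  - by rewrite !mxE.
  rewrite selfadj -scalemxAl -mulmxA NT // mul_mx_scalar scalerA mulVf ?gt_eqF //.
  by rewrite scale1r.
have [S [uS ES _]] := uniq A' B' fact'.
have [C EC] := congruence_matrix S.
have TC : T t - C = 0.
  apply: (symrows_span rankM fact) => i; have [symA _] := (psdmxP _).1 (psdA i).
  by rewrite mulmxBr -EC // -ES symvK subrr.
move: xt; rewrite (subr0_eq TC) -EC; last by rewrite !mxE !big_ord1 !mxE mulrC.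
have -> : S^T *m (x *m x^T) *m S = (S^T *m x) *m (S^T *m x)^T.
  by rewrite trmx_mul trmxK !mulmxA.
by rewrite detv_rank1 eqxx.
Qed.

(** * The dichotomy for rank-one factors, and the characterization *)

(** The dichotomy for two families of points. The separating form is moreover
    nonzero at some good point: this makes the deformation along it leave the
    orbit even when there is no point to separate. *)
Lemma separation_or_alternation2 (R : realType) n p q
    (a : 'I_p -> 'cV[R]_2) (c : 'I_q -> 'cV[R]_2) (P : pred 'I_p) (Q : pred 'I_q)
    (good : 'cV[R]_2 -> Prop) :
  (forall x, good x -> x != 0) -> (exists x, good x) ->
  (forall i, P i -> good (a i)) -> (forall j, Q j -> good (c j)) ->
  (forall i i', P i -> P i' -> i != i' -> det2 (a i) (a i') != 0) ->
  (forall j j', Q j -> Q j' -> j != j' -> det2 (c j) (c j') != 0) ->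
  (forall i j, P i -> Q j -> det2 (a i) (c j) != 0) ->
  (exists h : 'rV[R]_(n + n).+1,
     [/\ forall i, P i -> 0 < bform h (a i),
         forall j, Q j -> bform h (c j) < 0 &
         exists2 x, good x & bform h x != 0]) \/
  (exists (i : 'I_n.+1 -> 'I_p) (j : 'I_n.+1 -> 'I_q),
    [/\ injective i, injective j, forall k, P (i k), forall l, Q (j l) &
      sign_rigid (n + n) (fun k => a (i k)) (fun l => c (j l))]).
Proof.
move=> good_neq0 [x0 good0] good_a good_c det_a det_c det_ac.
pose x (k : 'I_p + 'I_q) := match k with inl i => a i | inr j => c j end.
pose s (k : 'I_p + 'I_q) := if k is inl _ then true else false.
pose S0 := [set k : 'I_p + 'I_q | match k with inl i => P i | inr j => Q j end].
have good_x k : k \in S0 -> good (x k).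
  by rewrite inE; case: k => [i /good_a|j /good_c].
have [||[h sep]|[f [g [f_inj g_inj fP gQ rig]]]] :=
  @separation_or_alternation R _ x s n S0.
- by move=> k /good_x/good_neq0.
- move=> [i|j] [i'|j']; rewrite !inE => Pk Pl; rewrite ?(inj_eq inl_inj) ?(inj_eq inr_inj).
  + exact: det_a.
  + by move=> _; apply: det_ac.
  + by move=> _; rewrite det2C oppr_eq0 det_ac.
  + exact: det_c.
- have [k0 k0S|S0_empty] := pickP (mem S0).
    left; exists h; split=> [i Pi|j Qj|].
    + by have := sep (inl i); rewrite inE; apply.
    + by have := sep (inr j); rewrite inE; apply.
    exists (x k0); first exact: good_x.
    by have := sep k0 k0S; case: (s k0) => [/gt_eqF ->|/lt_eqF ->].
  (* Without points every form separates; take one that is nonzero at x0. *)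
  have [y ny] := exists_det2_neq0 (good_neq0 _ good0).
  have [g Eg] := prod_det2_bform (fun _ : 'I_(n + n) => y).
  left; exists g; split=> [i Pi|j Qj|].
  + by have := S0_empty (inl i); rewrite /= inE Pi.
  + by have := S0_empty (inr j); rewrite /= inE Qj.
  by exists x0 => //; rewrite Eg; apply/prodf_neq0.
- have /choice[i Ei] k : exists i, f k = inl i.
    by have := fP k; case: (f k) => [u|u] [] // *; exists u.
  have /choice[j Ej] k : exists j, g k = inr j.
    by have := gQ k; case: (g k) => [u|u] [] // *; exists u.
  right; exists i, j; split=> [k k' E|k k' E|k|k|h].
  + by apply: f_inj; rewrite !Ei E.
  + by apply: g_inj; rewrite !Ej E.
  + by have [] := fP k; rewrite Ei inE.
  + by have [] := gQ k; rewrite Ej inE.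
  move=> ha hc; have [||za zc] := rig h.
  + by move=> k; rewrite /= Ei; apply: ha.
  + by move=> l; rewrite /= Ej; apply: hc.
  by split=> [k|l]; [have := za k|have := zc l]; rewrite /= ?Ei ?Ej.
Qed.

Lemma det2_eq0_colinear (R : realType) (x y : 'cV[R]_2) :
  x != 0 -> det2 x y = 0 -> exists t, y = t *: x.
Proof.
move=> x_neq0; rewrite det2E => /eqP; rewrite subr_eq0 => /eqP E.
have eq2 (u v : 'cV[R]_2) : u 0 0 = v 0 0 -> u 1 0 = v 1 0 -> u = v.
  by move=> *; apply/matrixP => i j; rewrite ord1; case: (ord2P i) => ->.
have [x0|x0] := eqVneq (x 0 0) 0.
  have x1 : x 1 0 != 0.
    by apply: contraNneq x_neq0 => x1; apply/eqP/eq2; rewrite mxE.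
  exists (y 1 0 / x 1 0); apply: eq2; rewrite !mxE; last by field.
  by apply: (mulfI x1); rewrite -E x0; field.
exists (y 0 0 / x 0 0); apply: eq2; rewrite !mxE; first by field.
by apply: (mulfI x0); rewrite E; field.
Qed.

Lemma trace_rank1 (R : realType) (a b : 'cV[R]_2) :
  \tr ((a *m a^T) *m (b *m b^T)) = dotv a b ^+ 2.
Proof.
by rewrite dotvE /mxtrace sum2 !mxE !sum2 !mxE !big_ord1 !mxE; ring.
Qed.

(** Two nonzero psd factors with product of trace zero are both singular, as a
    definite matrix pairs positively with every nonzero psd matrix. *)
Lemma zero_pair_rank1 (R : realType) (A B : 'M[R]_2) :
  psdmx A -> psdmx B -> A != 0 -> B != 0 -> \tr (A *m B) = 0 ->
  \rank A = 1%N /\ \rank B = 1%N.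
Proof.
move=> psdA psdB A0 B0.
have [symA pA] := (psdmxP _).1 psdA; have [symB pB] := (psdmxP _).1 psdB.
rewrite trace_pairv // => E.
have qA : detv (symv A) = 0.
  apply/eqP; apply: contraTT isT => qA; have : pairv (symv A) (adjv B) != 0.
    by apply: pairv_neq0; [rewrite lt_def qA; case: pA|exact/psdv_adjv|rewrite adjv_eq0].
  by rewrite E eqxx.
have qB : detv (adjv B) = 0.
  apply/eqP; apply: contraTT isT => qB; have : pairv (adjv B) (symv A) != 0.
    by apply: pairv_neq0; [rewrite lt_def qB; case/psdv_adjv: pB| |rewrite symv_eq0].
  by rewrite pairvC E eqxx.
split; apply: psd_rank1 => //.
by move: qB; rewrite /detv !mxE /= sqrrN mulrC.
Qed.

Lemma no_zero_factor (R : realType) p q (M : 'M[R]_(p, q))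
    (A : 'I_p -> 'M[R]_2) (B : 'I_q -> 'M[R]_2) :
  psd_factorization M A B ->
  (forall i, exists j, M i j != 0) -> (forall j, exists i, M i j != 0) ->
  (forall i, A i != 0) /\ (forall j, B j != 0).
Proof.
move=> [_ _ EM] rowM colM; split=> [i|j].
  have [j] := rowM i; rewrite EM; apply: contraNneq => ->.
  by rewrite mul0mx mxtrace0.
have [i] := colM j; rewrite EM; apply: contraNneq => ->.
by rewrite mulmx0 mxtrace0.
Qed.

Theorem theorem1 (R : realType) (p q : nat) (M : 'M[R]_(p, q))
    (A : 'I_p -> 'M[R]_2) (B : 'I_q -> 'M[R]_2)
    (a : 'I_p -> 'cV[R]_2) (b : 'I_q -> 'cV[R]_2)
    (M_ge0 : forall i j, 0 <= M i j)
    (rankM : \rank M = 3%N)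
    (psd_rankM : psd_rank_eq M 2)
    (factM : psd_factorization M A B)
    (Aa : forall i, \rank (A i) = 1%N -> A i = a i *m (a i)^T)
    (Bb : forall j, \rank (B j) = 1%N -> B j = b j *m (b j)^T)
    (det_a : forall i i', \rank (A i) = 1%N -> \rank (A i') = 1%N ->
       i <> i' -> det2 (a i) (a i') <> 0)
    (det_b : forall j j', \rank (B j) = 1%N -> \rank (B j') = 1%N ->
       j <> j' -> det2 (b j) (b j') <> 0) :
  ((forall i j, 0 < M i j) ->
     (unique_psd_factorization M A B <->
      exists (i : 'I_3 -> 'I_p) (j : 'I_3 -> 'I_q),
        [/\ rank_one_triples A B i j,
            forall k l, dotv (a (i k)) (b (j l)) <> 0
          & sign_system (fun k => a (i k)) (fun l => b (j l))]))
  /\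
  (#|[set ij : 'I_p * 'I_q | M ij.1 ij.2 == 0]| = 1%N ->
     unique_psd_factorization M A B ->
     exists (i : 'I_3 -> 'I_p) (j : 'I_3 -> 'I_q),
       [/\ rank_one_triples A B i j,
           forall k l, dotv (a (i k)) (b (j l)) = 0 <-> k = 0 /\ l = 0
         & sign_system (fun k => a (i k)) (fun l => b (j l))]).
Proof.
have [psdA psdB EM] := factM.
have entry i j : \rank (A i) = 1%N -> \rank (B j) = 1%N ->
    M i j = dotv (a i) (b j) ^+ 2.
  by move=> rA rB; rewrite EM (Aa i rA) (Bb j rB) trace_rank1.
have {}det_a i i' : \rank (A i) = 1%N -> \rank (A i') = 1%N -> i != i' ->
    det2 (a i) (a i') != 0.
  by move=> ri ri' /eqP ne; apply/eqP/det_a.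
have {}det_b j j' : \rank (B j) = 1%N -> \rank (B j') = 1%N -> j != j' ->
    det2 (b j) (b j') != 0.
  by move=> rj rj' /eqP ne; apply/eqP/det_b.
have le3p : (2 < p)%N by rewrite -rankM rank_leq_row.
have le3q : (2 < q)%N by rewrite -rankM rank_leq_col.
have a_neq0 i : \rank (A i) = 1%N -> a i != 0.
  move=> ri; apply: contraPneq ri => ai0 ri.
  by move: (ri); rewrite Aa // ai0 mul0mx mxrank0.
have perp_neq0 j : \rank (B j) = 1%N -> perp (b j) != 0.
  move=> rj; apply: contraPneq rj => bj0 rj; have b0 : b j = 0.
    move/colP: bj0 => bj0; have := bj0 0; have := bj0 1; rewrite !mxE /= => b0 b1.
    apply/colP => k; rewrite mxE; case: (ord2P k) => -> //.
    by apply/eqP; rewrite -oppr_eq0 b1.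
  by move: (rj); rewrite Bb // b0 mul0mx mxrank0.
split=> [M_gt0|one_zero].
- have [A0 B0] : (forall i, A i != 0) /\ (forall j, B j != 0).
    apply: (no_zero_factor factM) => k.
      by exists (Ordinal le3q); rewrite gt_eqF.
    by exists (Ordinal le3p); rewrite gt_eqF.
  have dot_neq0 i j : \rank (A i) = 1%N -> \rank (B j) = 1%N -> dotv (a i) (b j) != 0.
    by move=> ri rj; rewrite -sqrf_eq0 -entry // gt_eqF.
  split=> [uniq|[i [j [[i_inj j_inj ri rj] _ sys]]]]; last first.
    apply: (rigid_unique (a := fun k => a (i k)) (b := fun l => b (j l))
      (i := i) (j := j) rankM factM) => [k|l|l|h]; [exact: Aa|exact: Bb|exact: B0|].
    apply: (sign_system_rigid (a := fun k => a (i k)) (b := fun l => b (j l)))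
      => // [k l ne|k l ne|k l].
    + by apply: det_a => //; rewrite (inj_eq i_inj).
    + by apply: det_b => //; rewrite (inj_eq j_inj).
    exact: dot_neq0.
  have [|||||||[h [ha hb [x _ hx]]]|[i [j [i_inj j_inj /= ri rj rig]]]] :=
    @separation_or_alternation2 R 2 p q a (fun j => perp (b j))
      (fun i => \rank (A i) == 1%N) (fun j => \rank (B j) == 1%N) (fun x => x != 0).
  + by [].
  + exists (const_mx 1); apply/eqP => /colP/(_ 0); rewrite !mxE => /eqP.
    by rewrite oner_eq0.
  + by move=> i /eqP; apply: a_neq0.
  + by move=> j /eqP; apply: perp_neq0.
  + by move=> i i' /eqP ri /eqP ri'; apply: det_a.
  + by move=> j j' /eqP rj /eqP rj'; rewrite det2_perp; apply: det_b.
  + by move=> i j /eqP ri /eqP rj; rewrite det2_perpr dot_neq0.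
  + exfalso; apply: (deformation_not_unique (h := h) rankM factM A0 B0 Aa Bb) uniq.
    * by move=> i /eqP ri; left; apply: ha.
    * by move=> j /eqP rj; left; apply: hb.
    * by exists x.
  exists i, j; split.
  + by split=> // k; apply/eqP.
  + by move=> k l; apply/eqP/dot_neq0; apply/eqP.
  exact: rigid_sign_system.
move=> uniq.
have [[i0 j0] Eset] := cards1P (introT eqP one_zero).
have zero i j : (M i j == 0) = (i == i0) && (j == j0).
  by have /setP/(_ (i, j)) := Eset; rewrite !inE xpair_eqE.
have [A0 B0] : (forall i, A i != 0) /\ (forall j, B j != 0).
  have other n (k : 'I_n) : (2 < n)%N -> exists k' : 'I_n, k' != k.
    move=> lt2n; have lt0n := ltn_trans (isT : 0 < 2)%N lt2n.
    have lt1n := ltn_trans (isT : 1 < 2)%N lt2n.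
    have [Ek|ne] := eqVneq (Ordinal lt0n) k; last by exists (Ordinal lt0n).
    by exists (Ordinal lt1n); rewrite -Ek.
  apply: (no_zero_factor factM) => k.
    by have [j nej] := other q j0 le3q; exists j; rewrite zero (negPf nej) andbF.
  by have [i nei] := other p i0 le3p; exists i; rewrite zero (negPf nei).
have [ri0 rj0] : \rank (A i0) = 1%N /\ \rank (B j0) = 1%N.
  by apply: zero_pair_rank1 => //; rewrite -EM; apply/eqP; rewrite zero !eqxx.
have dotE i j : \rank (A i) = 1%N -> \rank (B j) = 1%N ->
    (dotv (a i) (b j) == 0) = (i == i0) && (j == j0).
  by move=> ri rj; rewrite -sqrf_eq0 -entry // zero.
have [t Et] : exists t, perp (b j0) = t *: a i0.
  apply: det2_eq0_colinear; first exact: a_neq0.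
  by rewrite det2_perpr; apply/eqP; rewrite dotE // !eqxx.
have [|||||||[g [ga gb [x good_x gx]]]|[i [j [i_inj j_inj /= ri rj rig]]]] :=
  @separation_or_alternation2 R 1 p q a (fun j => perp (b j))
    (fun i => (\rank (A i) == 1%N) && (i != i0))
    (fun j => (\rank (B j) == 1%N) && (j != j0)) (fun x => det2 x (a i0) != 0).
- by move=> x; apply: contraNneq => ->; rewrite det2E !mxE !mul0r subrr.
- have [y ny] := exists_det2_neq0 (a_neq0 _ ri0).
  by exists y; rewrite det2C oppr_eq0.
- by move=> i /andP[/eqP ri nei]; apply: det_a.
- by move=> j /andP[/eqP rj nej]; rewrite det2_perpl oppr_eq0 dotE // (negPf nej) andbF.
- by move=> i i' /andP[/eqP ri _] /andP[/eqP ri' _]; apply: det_a.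
- by move=> j j' /andP[/eqP rj _] /andP[/eqP rj' _]; rewrite det2_perp; apply: det_b.
- move=> i j /andP[/eqP ri nei] /andP[/eqP rj nej].
  by rewrite det2_perpr dotE // (negPf nei).
- exfalso; have [h [Eh [k Ek]]] := generator_tangent (a i0) g.
  apply: (deformation_not_unique (h := h) rankM factM A0 B0 Aa Bb) uniq.
  + move=> i ri; have [->|nei] := eqVneq i i0; [by right; exists k|left].
    rewrite Eh mulr_gt0 ?ga ?ri ?eqxx // lt_def sqr_ge0 andbT sqrf_eq0.
    exact: det_a.
  + move=> j rj; have [->|nej] := eqVneq j j0; [right; exists k|left].
      rewrite Et; have -> : symv (t *: a i0 *m (t *: a i0)^T) =
          t ^+ 2 *: symv (a i0 *m (a i0)^T).
        by rewrite !symv_rank1; apply: row3P; rewrite !mxE /=; ring.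
      by rewrite -scalemxAl Ek !scalerA mulrC.
    rewrite Eh pmulr_rlt0 ?gb ?rj ?eqxx // lt_def sqr_ge0 andbT sqrf_eq0.
    by rewrite det2_perpl oppr_eq0 dotE // (negPf nej) andbF.
  by exists x; rewrite Eh mulf_neq0 // sqrf_eq0.
(* The zero entry provides the first index of each triple. *)
pose ii (k : 'I_3) := if unlift 0 k is Some k' then i k' else i0.
pose jj (l : 'I_3) := if unlift 0 l is Some l' then j l' else j0.
have iiE k : ii (lift 0 k) = i k by rewrite /ii liftK.
have jjE l : jj (lift 0 l) = j l by rewrite /jj liftK.
have ii0 : ii 0 = i0 by rewrite /ii unlift_none.
have jj0 : jj 0 = j0 by rewrite /jj unlift_none.
have rii k : \rank (A (ii k)) = 1%N /\ (ii k == i0) = (k == 0).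
  rewrite /ii; case: unliftP => [k' ->|->]; last by rewrite !eqxx.
  by have /andP[/eqP -> /negPf ->] := ri k'.
have rjj l : \rank (B (jj l)) = 1%N /\ (jj l == j0) = (l == 0).
  rewrite /jj; case: unliftP => [l' ->|->]; last by rewrite !eqxx.
  by have /andP[/eqP -> /negPf ->] := rj l'.
exists ii, jj; split.
- split=> [k k'|l l'|k|l]; do ?[by have [] := rii k|by have [] := rjj l].
    rewrite /ii; case: unliftP => [u ->|->]; case: unliftP => [u' ->|->] //.
    + by move/i_inj ->.
    + by move=> E; have /andP[_] := ri u; rewrite E eqxx.
    + by move=> E; have /andP[_] := ri u'; rewrite -E eqxx.
  rewrite /jj; case: unliftP => [u ->|->]; case: unliftP => [u' ->|->] //.
  + by move/j_inj ->.
  + by move=> E; have /andP[_] := rj u; rewrite E eqxx.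
  + by move=> E; have /andP[_] := rj u'; rewrite -E eqxx.
- move=> k l; have [rk Ek] := rii k; have [rl El] := rjj l.
  split=> [/eqP|[-> ->]]; last by apply/eqP; rewrite dotE ?ii0 ?jj0 ?eqxx.
  by rewrite dotE // Ek El => /andP[/eqP -> /eqP ->].
apply: (rigid_sign_system_tangent (t := t)); first by rewrite ii0 jj0.
move=> h ha hb; have [||za zb] := rig h.
- by move=> k; rewrite -iiE; apply: ha.
- by move=> l; rewrite -jjE; apply: hb.
by split=> [k|l]; rewrite ?iiE ?jjE.
Qed.
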